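(* Let $\mathscr S$ be either $\mathscr D(l,a_1,a_2,a_3,a_4)$ for some $l\in\mathbb Z_{\ge0}\cup\{\infty\}$ and $(a_1,a_2,a_3,a_4)\in[0,\infty]^4$ with $l\le a_1\le a_2\le a_3\le a_4$, or $\mathscr S=\mathscr U$. Let $n\in\mathbb Z_{\ge1}$, let $H$ be a compact metrizable space, let $v_1,\dots,v_{n+1}$ be mutually distinct points of $H$, and let $(X_1,d_1),\dots,(X_{n+1},d_{n+1})$ be compact metric spaces in $\mathscr S$ such that $\mathcal{GH}((X_i,d_i),(X_j,d_j))>0$ for all distinct $i,j$. Then there exists a topological embedding $\Phi:H\to\mathscr S$ such that $\Phi(v_i)=(X_i,d_i)$ for all $i\in\{1,\dots,n+1\}$.
   Context: $\mathscr M$ is the set of all isometry classes of non-empty compact metric spaces, equipped with the Gromov–Hausdorff distance $\mathcal{GH}$ (the infimum of the Hausdorff distances between $i(X)$ and $j(Y)$ over all isometric embeddings $i:X\to Z$, $j:Y\to Z$ into a common metric space $Z$). An isometry class is denoted by a representative $(X,d)$. Subsets of $\mathscr M$ carry the topology induced by $\mathcal{GH}$. $\mathscr U\subset\mathscr M$ is the set of all compact ultrametric spaces (ultrametric: $d(x,y)\le\max\{d(x,z),d(z,y)\}$). $\mathscr D(l,a_1,a_2,a_3,a_4)\subset\mathscr M$ is the set of all compact metric spaces $(X,d)$ with $\dim_TX=l$, $\dim_H(X,d)=a_1$, $\dim_P(X,d)=a_2$, $\overline{\dim}_B(X,d)=a_3$, $\dim_A(X,d)=a_4$, where the dimensions are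 as follows. $\dim_T X$ is the topological (covering) dimension of $X$. $B(x,r)$ denotes the closed ball with center $x$ and radius $r$, and subsets carry the restricted metric. Hausdorff dimension: for $s\in[0,\infty)$ and $\delta>0$ let $\mathcal H^s_\delta(A)=\inf\{\sum_{i\ge1}\mathrm{diam}(A_i)^s : A\subset\bigcup_{i\ge 1}A_i,\ \mathrm{diam}(A_i)<\delta\}$ and $\mathcal H^s(A)=\sup_{\delta>0}\mathcal H^s_\delta(A)$; then $\dim_H(X,d)=\inf\{s\in[0,\infty):\mathcal H^s(X)=0\}$ (with $\inf\emptyset=\infty$). Packing dimension (radius-type): for $A\subset X$, $s\in[0,\infty)$ and $\delta>0$, let $\widetilde{\mathcal P}^s_\delta(A)$ be the supremum of $\sum_i r_i^s$ over all finite or countable sequences $\{r_i\}$ in $(0,\delta)$ for which there are points $x_i\in A$ such that the closed balls $B(x_i,r_i)$ are pairwise disjoint. Put $\widetilde{\mathcal P}^s_0(A)=\inf_{\delta>0}\widetilde{\mathcal P}^s_\delta(A)$ and $\mathcal P^s(A)=\inf\{\sum_{i\ge1}\widetilde{\mathcal P}^s_0(S_i): A\subset\bigcup_{i\ge1}S_i\}$; then $\dim_P(X,d)=\inf\{s\in[0,\infty):\mathcal P^s(X)=0\}$ (with $\inf\emptyset=\infty$). Upper box dimension: $N_d(X,r)$ is the least cardinality of a subset $A\subset X$ with $X=\bigcup_{a\in A}B(a,r)$, and $\overline{\dim}_B(X,d)=\limsup_{r\to0}\frac{\log N_d(X,r)}{-\log r}$. Assouad dimension: $\dim_A(X,d)$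 is the infimum of all $\lambda\in(0,\infty)$ for which there is $C\in(0,\infty)$ such that $N_d(B(x,R),r)\le C(R/r)^\lambda$ for all $x\in X$ and all $R>r>0$; it is $\infty$ if no such $\lambda$ exists. *)

(* Defs.v *)
From HB Require Import structures.
From mathcomp Require Import all_boot all_order all_algebra.
From mathcomp Require Import all_classical all_reals all_analysis.

Set Implicit Arguments.
Unset Strict Implicit.
Unset Printing Implicit Defensive.

Import Order.TTheory GRing.Theory Num.Theory.
Import numFieldNormedType.Exports.

Local Open Scope classical_set_scope.
Local Open Scope ring_scope.

HB.mixin Record Metric_isCompactMetric (K : numDomainType) M & Metric K M := {
  compact_metric_compact : compact [set: M] ;
  compact_metric_nonempty : [set: M] !=set0
}.

(* Pitfall: [gh_space] below is built from all of [compactMetricType R] and is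
   itself a [choiceType], so the carriers of compact metric spaces live in a
   strictly smaller universe than [Equality.sort]. Carriers such as
   [{x : T | P x}], products, sums and function types over [R] are fine, but
   [set_type], [{ffun _ -> _}] and matrix types are too large, and an instance
   declared on them is silently dropped. *)
#[short(type="compactMetricType")]
HB.structure Definition CompactMetric (K : numDomainType) :=
  { M of Metric K M & Metric_isCompactMetric K M }.

Definition is_isometric_embedding (R : realType) (X Y : metricType R)
    (f : X -> Y) : Prop :=
  forall x y, mdist (f x) (f y) = mdist x y.

Definition isometric (R : realType) (X Y : metricType R) : Prop :=
  exists2 f : X -> Y, is_isometric_embedding f & bijective f.

Section dimensions.
Context {R : realType} (X : metricType R).
Implicit Types (A S : set X) (x : X) (r s : R).

(* The library's [closed_ball] is the closure of the open ball, which can be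
   smaller than the set below. *)
Definition cball x r : set X := [set y | mdist x y <= r].

(* The element 0 only matters for the empty set. *)
Definition diam A : \bar R :=
  ereal_sup (0%E |` [set (mdist z.1 z.2)%:E | z in A `*` A]).

Local Open Scope ereal_scope.

Definition hausdorff_premeasure s (delta : R) A : \bar R :=
  ereal_inf [set \sum_(0 <= i <oo) poweR (diam (F i)) s |
    F in [set F : nat -> set X |
      A `<=` \bigcup_i F i /\ forall i, diam (F i) < delta%:E]].

Definition hausdorff_measure s A : \bar R :=
  ereal_sup [set hausdorff_premeasure s delta A | delta in [set e | (0 < e)%R]].

Definition hausdorff_dim : \bar R :=
  ereal_inf [set s%:E | s in
    [set s | (0 <= s)%R /\ hausdorff_measure s [set: X] = 0]].

(* A finite or countable family of balls is indexed by a set [I] of naturals;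
   the balls are taken in [X], only their centers have to lie in [A]. *)
Definition packing_premeasure s (delta : R) A : \bar R :=
  ereal_sup [set t | exists (I : set nat) (x : nat -> X) (r : nat -> R),
    [/\ forall i, I i -> A (x i),
        forall i, I i -> (0 < r i < delta)%R,
        trivIset I (fun i => cball (x i) (r i)) &
        t = \esum_(i in I) (powR (r i) s)%:E]].

Definition packing_premeasure0 s A : \bar R :=
  ereal_inf [set packing_premeasure s delta A | delta in [set e | (0 < e)%R]].

Definition packing_measure s A : \bar R :=
  ereal_inf [set \sum_(0 <= i <oo) packing_premeasure0 s (S i) |
    S in [set S : nat -> set X | A `<=` \bigcup_i S i]].

Definition packing_dim : \bar R :=
  ereal_inf [set s%:E | s in
    [set s | (0 <= s)%R /\ packing_measure s [set: X] = 0]].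

(* For a subset [S] with the restricted metric: the centers lie in [S]. *)
Definition covering_number S r : \bar R :=
  ereal_inf [set k%:R%:E | k in
    [set k : nat | exists A : set X,
      [/\ A `<=` S, (A #= `I_k)%card & S `<=` \bigcup_(a in A) cball a r]]].

Definition upper_box_dim : \bar R :=
  limf_esup (fun r => lne (covering_number [set: X] r) * (- ln r)^-1%:E) 0^'+.

Definition assouad_dim : \bar R :=
  ereal_inf [set lambda%:E | lambda in
    [set lambda | (0 < lambda)%R /\ exists2 C : R, (0 < C)%R &
      forall x (r rho : R), (0 < r < rho)%R ->
        covering_number (cball x rho) r <= (C * powR (rho / r) lambda)%:E]].

End dimensions.

(* Covering dimension: every finite open cover has a finite open refinement in
   which each point lies in at most n + 1 members. *)
Definition covering_dim_le (T : topologicalType) (n : nat) : Prop :=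
  forall U : set (set T), finite_set U -> U `<=` open ->
    \bigcup_(A in U) A = setT ->
  exists V : set (set T),
    [/\ finite_set V, V `<=` open, \bigcup_(B in V) B = setT,
        forall B, V B -> exists2 A, U A & B `<=` A &
        forall x, ([set B | V B /\ B x] #<= `I_n.+1)%card].

(* This is the covering dimension for nonempty spaces (the value -1 is not
   reached). *)
Definition topological_dim (R : realType) (T : topologicalType) : \bar R :=
  ereal_inf [set n%:R%:E | n in covering_dim_le T].

Definition is_ultrametric (R : realType) (X : metricType R) : Prop :=
  forall x y z : X, mdist x y <= Num.max (mdist x z) (mdist z y).

Definition hausdorff_dist (R : realType) (Z : metricType R) (A B : set Z)
    : \bar R :=
  maxe (ereal_sup [set ereal_inf [set (mdist a b)%:E | b in B] | a in A])
       (ereal_sup [set ereal_inf [set (mdist a b)%:E | a in A] | b in B]).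

Definition gh_dist (R : realType) (X Y : metricType R) : \bar R :=
  ereal_inf [set t | exists (Z : metricType R) (i : X -> Z) (j : Y -> Z),
    [/\ is_isometric_embedding i, is_isometric_embedding j &
        t = hausdorff_dist (range i) (range j)]].

HB.instance Definition _ (R : realType) := gen_eqMixin (compactMetricType R).
HB.instance Definition _ (R : realType) :=
  gen_choiceMixin (compactMetricType R).

Section isometry_classes.
Context {R : realType}.

Definition isometricb (X Y : compactMetricType R) : bool := `[< isometric X Y >].

Lemma isometricb_refl : reflexive isometricb.
Proof. by move=> X; apply/asboolP; exists id => //; exists id. Qed.

Lemma isometricb_sym : symmetric isometricb.
Proof.
suff sub X Y : isometricb X Y -> isometricb Y X.
  by move=> X Y; apply/idP/idP => /sub.
move=> /asboolP[f fi [g fK gK]]; apply/asboolP; exists g; last by exists f.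
by move=> x y; rewrite -fi !gK.
Qed.

Lemma isometricb_trans : transitive isometricb.
Proof.
move=> Y X Z /asboolP[f fi fb] /asboolP[g gi gb]; apply/asboolP.
by exists (g \o f); [move=> x y /=; rewrite gi fi|exact: bij_comp].
Qed.

Canonical isometric_equiv :=
  EquivRel isometricb isometricb_refl isometricb_sym isometricb_trans.

End isometry_classes.

Section gh_space.
Local Open Scope quotient_scope.

Definition gh_space (R : realType) : Type := {eq_quot @isometric_equiv R}.

HB.instance Definition _ (R : realType) := Choice.on (gh_space R).

Definition iso_class (R : realType) (X : compactMetricType R) : gh_space R :=
  \pi_({eq_quot @isometric_equiv R}) X.

Definition gh_repr (R : realType) (c : gh_space R) : compactMetricType R :=
  repr (c : {eq_quot @isometric_equiv R}).

Context {R : realType}.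

Definition gh_open (U : set (gh_space R)) : Prop :=
  forall c, U c -> exists2 e : R, 0 < e &
    forall c', (gh_dist (gh_repr c) (gh_repr c') < e%:E)%E -> U c'.

Lemma gh_openT : gh_open setT.
Proof. by move=> c _; exists 1. Qed.

Lemma gh_openI : setI_closed gh_open.
Proof.
move=> U V oU oV c [/oU[e e0 eU] /oV[e' e'0 eV]].
exists (Num.min e e'); first by rewrite lt_min e0.
move=> c' cc'; split; [apply: eU|apply: eV].
  by rewrite (lt_le_trans cc')// lee_fin ge_min lexx.
by rewrite (lt_le_trans cc')// lee_fin ge_min lexx orbT.
Qed.

Lemma gh_open_bigU (I : Type) (f : I -> set (gh_space R)) :
  (forall i, gh_open (f i)) -> gh_open (\bigcup_i f i).
Proof.
move=> fo c [i _ /fo[e e0 ef]].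
by exists e => // c' /ef; exists i.
Qed.

HB.instance Definition _ :=
  isOpenTopological.Build (gh_space R) gh_openT gh_openI gh_open_bigU.

End gh_space.

Definition dim_class (R : realType) (l a1 a2 a3 a4 : \bar R)
    : set (gh_space R) :=
  [set iso_class X | X in [set X : compactMetricType R |
    [/\ topological_dim R X = l, hausdorff_dim X = a1, packing_dim X = a2,
        upper_box_dim X = a3 & assouad_dim X = a4]]].

Definition ultrametric_class (R : realType) : set (gh_space R) :=
  [set iso_class X | X in [set X : compactMetricType R | is_ultrametric X]].
Arguments ultrametric_class : clear implicits.

Definition is_metric (R : realType) (T : Type) (d : T -> T -> R) : Prop :=
  [/\ forall x y, 0 <= d x y, forall x y, d x y = 0 <-> x = y,
      forall x y, d x y = d y x & forall x y z, d x z <= d x y + d y z].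

Definition metrizable (R : realType) (T : topologicalType) : Prop :=
  exists2 d : T -> T -> R, is_metric d &
    forall x (A : set T),
      nbhs x A <-> exists2 e : R, 0 < e & [set y | d x y < e] `<=` A.

Definition topological_embedding (T T' : topologicalType) (f : T -> T')
    : Prop :=
  [/\ injective f, continuous f &
      forall A, open A -> exists2 B, open B & f @` A = range f `&` B].

(* Main.v *)
(**
  Fix a metric on [H] and write [e(h)] for the distance from [h] to the points
  [v_i]. For [h] off these points, [Phi(h)] is the union of all the [X_j] and of
  a sequence [q_k] with its limit: the metric of [X_j] is truncated at a height
  [c_j(h) >= e(h)], that of the sequence is [max(t_k(h), t_l(h))], and the
  pieces are glued at their base points with a gap [e(h)]. At [h = v_i] only
  [c_i] survives, all the other pieces collapse to the base point of [X_i], and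
  [Phi(v_i)] is [X_i]. All parameters are Lipschitz in [h], whence continuity.

  Below the scale [e(h)] nothing was truncated: [Phi(h)] is locally the disjoint
  union of the [X_j] and of the sequence, which is ultrametric and has all its
  dimensions equal to 0, so [Phi(h)] belongs to the class [S].

  For injectivity, count the points that are isolated at scale [r < e(h)]: those
  of the [X_j], which do not depend on [h], and the [q_k] with [t_k(h) > r].
  Hence the isometry class of [Phi(h)] determines [t_k(h)] for all large [k].
  These numbers encode [min(1, d(x_k, h))] where [x_k] visits every open set
  infinitely often, and they determine [h]. A continuous injection of a compact
  space into the Hausdorff space of isometry classes is an embedding.
*)

Require Import Defs.
From HB Require Import structures.
From mathcomp Require Import finmap.
From mathcomp Require Import all_boot all_order all_algebra.
From mathcomp Require Import all_classical all_reals all_analysis.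
From mathcomp Require Import lra.

Set Implicit Arguments.
Unset Strict Implicit.
Unset Printing Implicit Defensive.

Import Order.TTheory GRing.Theory Num.Theory.

Local Open Scope classical_set_scope.
Local Open Scope ring_scope.

(** * Compact metric spaces *)

(** Truncating, rather than rescaling, leaves all distances below [e(h)] unchanged. By compactness
    every dimension can be read off at such scales, and the isolated points of the [X_j] at small
    scales are the same for all [h]. Nothing else is known about these points, but compactness makes
    them finitely many at each scale, so an isometry is impossible as soon as one of two spaces has
    all the isolated points of the other and one more. The gaps are maxima and not sums because this
    preserves ultrametricity, so that one construction serves both kinds of classes. The height of
    [X_j] has to vanish at the other [v_i] and to exceed the diameter of [X_j] at [v_j]; a large
    factor [L] reconciles the two and becomes the Lipschitz constant. All the distances live on one
    carrier and become a pseudometric at [v_i], so continuity is an estimate of the distortion of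
    correspondences. *)

(* Pitfall: this alias is universe-monomorphic and is used to build compact
   metric spaces, so its carriers are as small as theirs; it does not apply to
   the carrier of an arbitrary [metricType]. *)
Definition metric_space (R : realType) (T : Type) (d : T -> T -> R)
  (hd : is_metric d) : Type := T.

Section metric_space.
Variables (R : realType) (T : Type) (d : T -> T -> R) (hd : is_metric d).

Let d0 x : d x x = 0. Proof. by case: hd => _ h _ _; apply/h. Qed.
Let dp x y : d x y = 0 -> x = y. Proof. by case: hd => _ h _ _ /h. Qed.
Let ds x y : d x y = d y x. Proof. by case: hd. Qed.
Let dt y x z : d x z <= d x y + d y z. Proof. by case: hd. Qed.

HB.instance Definition _ := gen_eqMixin (metric_space hd).
HB.instance Definition _ := gen_choiceMixin (metric_space hd).
HB.instance Definition _ := @isMetric.Build R (metric_space hd) d d0 dp ds dt.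
End metric_space.

Definition compact_metric_space (R : realType) (T : Type) (d : T -> T -> R)
  (hd : is_metric d) (hc : compact [set: metric_space hd]) (t : T) : Type :=
  metric_space hd.

Section compact_metric_space.
Variables (R : realType) (T : Type) (d : T -> T -> R) (hd : is_metric d).
Variables (hc : compact [set: metric_space hd]) (t : T).

HB.instance Definition _ := Metric.on (compact_metric_space hc t).

Let hn : [set: compact_metric_space hc t] !=set0. Proof. by exists t. Qed.

HB.instance Definition _ :=
  @Metric_isCompactMetric.Build R (compact_metric_space hc t) hc hn.
End compact_metric_space.

Lemma nbhs_mdist (R : realType) (X : metricType R) (x : X) (e : R) :
  0 < e -> nbhs x [set y | mdist x y < e].
Proof.
by move=> e0; have := nbhsx_ballx x e e0; rewrite ballEmdist.
Qed.

Lemma mdist_nbhs (R : realType) (X : metricType R) (x : X) (A : set X) :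
  nbhs x A -> exists2 e : R, 0 < e & [set y | mdist x y < e] `<=` A.
Proof. by move=> /nbhs_ballP[e e0]; rewrite ballEmdist; exists e. Qed.

(** The function [d] is kept apart from the topology so that the lemma also applies to [H], whose
    metric is not part of its structure. *)
Lemma finite_net (R : realType) (T : topologicalType) (d : T -> T -> R) :
  compact [set: T] ->
  (forall x (e : R), 0 < e -> nbhs x [set y | d x y < e]) ->
  forall e : R, 0 < e ->
  exists s : seq T, forall y, exists2 x, x \in s & d x y < e.
Proof.
(* Otherwise the sets of points far from a finite set form a filter base
   without cluster point. *)
move=> cT dn e e0; apply: contrapT => nnet.
pose far (s : seq T) := [set y | forall x, x \in s -> ~ d x y < e].
have FF : ProperFilter (filter_from [set: seq T] far).
  apply: filter_from_proper.
    apply: filter_from_filter; first by exists [::].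
    move=> s s' _ _; exists (s ++ s') => // y sy; split=> x xs; apply: sy.
      by rewrite mem_cat xs.
    by rewrite mem_cat xs orbT.
  move=> s _; apply: contrapT => /set0P/negP; rewrite negbK => /eqP s0.
  apply: nnet; exists s => y; apply: contrapT => ny.
  have : far s y by move=> x xs dxy; apply: ny; exists x.
  by rewrite s0.
have [|p [_ clp]] := cT _ FF; first by exists [::].
have [|y [py]] := clp (far [:: p]) _ _ (dn p e e0); first by exists [:: p].
by apply: py; rewrite mem_head.
Qed.

Section compact_metric.
Context {R : realType} (X : metricType R) (cX : compact [set: X]).

(** Two points attached to the same point of an [e / 2]-net are closer than [e], so an [e]-separated
    family injects into the net. *)
Lemma separated_bound (e : R) : 0 < e ->
  exists N, forall s : seq X, uniq s ->
    (forall x y, x \in s -> y \in s -> x != y -> e <= mdist x y) ->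
    (size s <= N)%N.
Proof.
move=> e0; have e20 : 0 < e / 2 by rewrite divr_gt0.
have [net netP] := finite_net cX (@nbhs_mdist R X) e20.
have /choice[c cP] y : exists x, x \in net /\ mdist x y < e / 2.
  by have [x] := netP y; exists x.
exists (size net) => s us sep.
rewrite -(size_map c s); apply: uniq_leq_size.
  rewrite map_inj_in_uniq// => x y xs ys cxy; apply: contrapT => /eqP xy.
  have := sep _ _ xs ys xy; apply/negP; rewrite -ltNge.
  rewrite (le_lt_trans (metric_triangle _ (c x) _))//.
  rewrite [ltRHS]splitr ltrD//; last by rewrite cxy; case: (cP y).
  by rewrite metric_sym; case: (cP x).
by move=> _ /mapP[x _ ->]; case: (cP x).
Qed.

(* The image of a maximal e-separated set is maximal, hence no point lies at
   distance e from the image. *)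
Lemma isometric_self_embedding_surj (f : X -> X) :
  is_isometric_embedding f -> forall x, exists y, f y = x.
Proof.
move=> fi x; apply: contrapT => nx.
have fc : continuous f.
  move=> y A /mdist_nbhs[e e0 eA]; rewrite /= /nbhs /=.
  by apply: filterS (nbhs_mdist y e0) => z yz; apply: eA; rewrite /= fi.
have cl : closed (range f).
  apply: compact_closed; first exact: metric_hausdorff.
  by apply: continuous_compact => //; exact: continuous_subspaceT.
have : nbhs x (~` range f).
  apply: open_nbhs_nbhs; split; first exact: closed_openC.
  by move=> [y _ yx]; apply: nx; exists y.
move=> /mdist_nbhs[e e0 ef].
have xf y : e <= mdist x (f y).
  by rewrite leNgt; apply/negP => /ef; apply; exists y.
have [N NP] := separated_bound e0.
pose P k := `[< exists2 s : seq X, uniq s & size s = k /\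
  (forall x y, x \in s -> y \in s -> x != y -> e <= mdist x y) >].
have exP : exists k, P k by exists 0%N; apply/asboolP; exists [::].
have ubP k : P k -> (k <= N)%N by move=> /asboolP[s us [<- /NP]]; exact.
case: (ex_maxnP exP ubP) => m /asboolP[s us [sm sep]] mmax.
suff : P m.+1 by move=> /mmax; rewrite ltnn.
apply/asboolP; exists (x :: map f s).
  rewrite /= map_inj_uniq//; last first.
    by move=> a b fab; apply: mdist_positivity; rewrite -fi fab mdistxx.
  by rewrite us andbT; apply/negP => /mapP[y _ xy]; apply: nx; exists y.
split; first by rewrite /= size_map sm.
move=> a b; rewrite !inE => /predU1P[->|/mapP[a' a's ->]].
  move=> /predU1P[->|/mapP[b' b's ->]]; first by rewrite eqxx.
  by move=> _; exact: xf.
move=> /predU1P[->|/mapP[b' b's ->]]; first by rewrite metric_sym => _; exact: xf.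
by rewrite fi => ab; apply: sep => //; apply: contra_neq ab => ->.
Qed.

End compact_metric.

(** * The Gromov-Hausdorff distance *)

Section gromov_hausdorff.
Context {R : realType}.
Implicit Types X Y Z : compactMetricType R.

Definition distortion_le (X Y : metricType R) (C : X -> Y -> Prop) (r : R) :=
  forall x y x' y', C x y -> C x' y' -> `|mdist x x' - mdist y y'| <= r.

Definition correspondence (X Y : metricType R) (C : X -> Y -> Prop) :=
  (forall x, exists y, C x y) /\ (forall y, exists x, C x y).

Lemma gh_dist_ge0 (X Y : metricType R) (x : X) : (0 <= gh_dist X Y)%E.
Proof.
apply: le_ereal_inf_tmp => _ [Z [i [j [_ _ ->]]]].
rewrite le_max; apply/orP; left; apply: le_trans (ereal_sup_ubound _); last first.
  by exists (i x) => //; exists x.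
by apply: le_ereal_inf_tmp => _ [b _ <-]; rewrite lee_fin mdist_ge0.
Qed.

Lemma gh_dist_sym (X Y : metricType R) : gh_dist X Y = gh_dist Y X.
Proof.
suff sub (U V : metricType R) : (gh_dist U V <= gh_dist V U)%E.
  by apply/eqP; rewrite eq_le !sub.
apply: ereal_inf_le_tmp => _ [Z [i [j [iP jP ->]]]].
exists Z, j, i; split=> //; rewrite /hausdorff_dist maxC.
by congr maxe; congr ereal_sup; apply: eq_imagel => a _;
  congr ereal_inf; apply: eq_imagel => b _; rewrite metric_sym.
Qed.

(** Points are related when their images in a common space are closer than [r]; moving both ends of
    a segment changes its length by less than [r + r]. *)
Lemma gh_dist_lt_correspondence (X Y : metricType R) (r : R) :
  (gh_dist X Y < r%:E)%E ->
  exists2 C, correspondence C & @distortion_le X Y C (r + r).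
Proof.
move=> /ereal_inf_lt[_ [Z [i [j [iP jP ->]]]]]; rewrite gt_max => /andP[ij ji].
exists (fun x y => mdist (i x) (j y) < r); first split=> [x|y].
- have : (ereal_inf [set (mdist (i x) b)%:E | b in range j] < r%:E)%E.
    by apply: le_lt_trans ij; apply: ereal_sup_ubound; exists (i x) => //; exists x.
  by move=> /ereal_inf_lt[_ [_ [y _ <-] <-]]; rewrite lte_fin; exists y.
- have : (ereal_inf [set (mdist a (j y))%:E | a in range i] < r%:E)%E.
    by apply: le_lt_trans ji; apply: ereal_sup_ubound; exists (j y) => //; exists y.
  by move=> /ereal_inf_lt[_ [_ [x _ <-] <-]]; rewrite lte_fin; exists x.
- move=> x y x' y' xy x'y'; rewrite -iP -jP ler_norml.
  have h1 := metric_triangle (i x) (j y) (i x').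
  have h2 := metric_triangle (j y) (j y') (i x').
  have h3 := metric_triangle (j y) (i x) (j y').
  have h4 := metric_triangle (i x) (i x') (j y').
  rewrite (metric_sym (j y') (i x')) in h2.
  rewrite (metric_sym (j y) (i x)) in h3.
  by apply/andP; split; lra.
Qed.

Section correspondence_gluing.
Variables (X Y : compactMetricType R) (C : X -> Y -> Prop) (r : R).
Hypotheses (r0 : 0 < r) (cC : correspondence C) (dC : distortion_le C (r + r)).

(** Lengths of the routes from [x] to [y] through one related pair, joined by a link of length [r],
    half of the allowed distortion. As [r] is positive, the two spaces stay disjoint and the glued
    distance is not just a pseudometric. *)
Let bridge (x : X) (y : Y) : set R :=
  [set t | exists x' y', C x' y' /\ t = mdist x x' + r + mdist y' y].

Let across x y := inf (bridge x y).

Let bridge_lb x y : lbound (bridge x y) r.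
Proof.
by move=> _ [x' [y' [_ ->]]]; have := mdist_ge0 x x'; have := mdist_ge0 y' y; lra.
Qed.

Let bridge_has_inf x y : has_inf (bridge x y).
Proof.
split; last by exists r; exact: bridge_lb.
by have [y' xy'] := cC.1 x; exists (mdist x x + r + mdist y' y), x, y'.
Qed.

Let across_le x y x' y' : C x' y' -> across x y <= mdist x x' + r + mdist y' y.
Proof. by move=> c; apply: ge_inf; [case: (bridge_has_inf x y)|exists x', y']. Qed.

Let le_across x y a :
  (forall x' y', C x' y' -> a <= mdist x x' + r + mdist y' y) -> a <= across x y.
Proof.
move=> h; apply: lb_le_inf; first by case: (bridge_has_inf x y).
by move=> _ [x' [y' [/h h' ->]]].
Qed.

Definition glue_dist (u v : X + Y) : R :=
  match u, v with
  | inl x, inl x' => mdist x x'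
  | inr y, inr y' => mdist y y'
  | inl x, inr y | inr y, inl x => across x y
  end.

Lemma glue_dist_metric : is_metric glue_dist.
Proof.
have r_across x y : r <= across x y.
  by apply: le_across => x' y' c; apply: (@bridge_lb x y); exists x', y'.
split.
- by move=> [x|y] [x'|y'] //=; rewrite ?mdist_ge0// (le_trans (ltW r0)).
- move=> [x|y] [x'|y'] /=; split.
  + by move=> /mdist_positivity ->.
  + by move=> [->]; exact: mdistxx.
  + by move=> h; have := r_across x y'; rewrite h leNgt r0.
  + by [].
  + by move=> h; have := r_across x' y; rewrite h leNgt r0.
  + by [].
  + by move=> /mdist_positivity ->.
  + by move=> [->]; exact: mdistxx.
- by move=> [x|y] [x'|y'] //=; rewrite metric_sym.
- have t1 x x' y : across x y <= mdist x x' + across x' y.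
    rewrite -lerBlDl; apply: le_across => a b ab.
    have := across_le x y ab; have := metric_triangle x x' a; lra.
  have t2 x y y' : across x y <= across x y' + mdist y' y.
    rewrite -lerBlDr; apply: le_across => a b ab.
    have := across_le x y ab; have := metric_triangle b y' y; lra.
  (* Crossing and coming back costs [r] twice, which pays for the distortion between [mdist a a']
     and [mdist b b']. *)
  have t3 x x' y : mdist x x' <= across x y + across x' y.
    rewrite -lerBlDr; apply: le_across => a b ab.
    rewrite lerBlDr -lerBlDl; apply: le_across => a' b' ab'.
    have := dC ab ab'; rewrite ler_norml => /andP[_].
    have := metric_triangle x a x'; have := metric_triangle a a' x'.
    have := metric_triangle b y b'; rewrite (metric_sym x' a') (metric_sym y b').
    lra.
  have t4 x y y' : mdist y y' <= across x y + across x y'.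
    rewrite -lerBlDr; apply: le_across => a b ab.
    rewrite lerBlDr -lerBlDl; apply: le_across => a' b' ab'.
    have := dC ab ab'; rewrite ler_norml => /andP[+ _].
    have := metric_triangle y b y'; have := metric_triangle b b' y'.
    have := metric_triangle a x a'; rewrite (metric_sym a x) (metric_sym y b).
    lra.
  move=> [x|x] [y|y] [z|z] /=; rewrite ?metric_triangle//.
  + by have := t1 z y x; rewrite (metric_sym z y); lra.
  + by have := t2 z x y; rewrite (metric_sym y x); lra.
Qed.

Lemma correspondence_gh_dist_le : (gh_dist X Y <= r%:E)%E.
Proof.
pose Z : metricType R := metric_space glue_dist_metric.
pose i (x : X) : Z := inl x; pose j (y : Y) : Z := inr y.
apply: (@le_trans _ _ (hausdorff_dist (range i) (range j))).
  by apply: ereal_inf_lbound; exists Z, i, j; split.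
rewrite ge_max; apply/andP; split; apply: ge_ereal_sup => _ [_ [z _ <-] <-].
  have [y zy] := cC.1 z; apply: (@le_trans _ _ (mdist (i z) (j y))%:E).
  - by apply: ereal_inf_lbound; exists (j y) => //; exists y.
  - by rewrite lee_fin; have := across_le z y zy; rewrite !mdistxx add0r addr0.
have [x xz] := cC.2 z; apply: (@le_trans _ _ (mdist (i x) (j z))%:E).
- by apply: ereal_inf_lbound; exists (i x) => //; exists x.
- by rewrite lee_fin; have := across_le x z xz; rewrite !mdistxx add0r addr0.
Qed.

End correspondence_gluing.

(** Correspondences compose and their distortions add. The bounds are strict because the infimum
    need not be attained, and [0 < r + s] is the length of the link in the gluing. *)
Lemma gh_dist_triangle X Y Z (r s : R) :
  0 < r + s ->
  (gh_dist X Y < r%:E)%E -> (gh_dist Y Z < s%:E)%E ->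
  (gh_dist X Z <= (r + s)%:E)%E.
Proof.
move=> rs0 /gh_dist_lt_correspondence[C [C1 C2] dC].
move=> /gh_dist_lt_correspondence[D [D1 D2] dD].
apply: (@correspondence_gh_dist_le _ _ (fun x z => exists y, C x y /\ D y z)) => //.
- split=> [x|z].
    by have [y xy] := C1 x; have [z yz] := D1 y; exists z, y.
  by have [y yz] := D2 z; have [x xy] := C2 y; exists x, y.
- move=> x z x' z' [y [xy yz]] [y' [x'y' y'z']].
  rewrite -(subrKA (mdist y y')) (le_trans (ler_normD _ _))//.
  by rewrite addrACA lerD ?dC ?dD.
Qed.

Lemma isometric_gh_dist X Y (e : R) :
  0 < e -> isometric X Y -> (gh_dist X Y < e%:E)%E.
Proof.
move=> e0 [f fi [g fK gK]]; apply: (@le_lt_trans _ _ (e / 2)%:E); last first.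
  by rewrite lte_fin ltr_pdivrMr// ltr_pMr// ltr1n.
apply: (@correspondence_gh_dist_le _ _ (fun x y => f x = y)).
- by rewrite divr_gt0.
- by split=> [x|y]; [exists (f x)|exists (g y)].
- by move=> x y x' y' <- <-; rewrite fi subrr normr0 addr_ge0// divr_ge0// ltW.
Qed.

(* Choose maps whose distortion tends to 0; by Tychonoff they have a cluster
   point in the product space Y^X. *)
Lemma gh_dist0_isometric_embedding X Y :
  (forall e : R, 0 < e -> (gh_dist X Y < e%:E)%E) ->
  exists f : X -> Y, is_isometric_embedding f.
Proof.
move=> h.
have /choice[f fP] (n : nat) : exists f : X -> Y,
    forall x x', `|mdist x x' - mdist (f x) (f x')| <= n.+1%:R^-1.
  have [|C [C1 _] dC] := @gh_dist_lt_correspondence X Y (n.+1%:R^-1 / 2).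
    by apply: h; rewrite divr_gt0// invr_gt0.
  have /choice[f fP] := C1; exists f => x x'.
  by rewrite [leRHS]splitr; exact: dC.
have := tychonoff (fun _ : X => @compact_metric_compact R Y).
have -> : [set f : X -> Y | forall i, [set: Y] (f i)] = [set: X -> Y].
  by apply/seteqP; split.
move=> /(_ (f @ \oo) _)[|g [_ clg]]; first exact: filterT.
exists g => x x'; apply/eqP; rewrite -subr_eq0 -normr_le0.
apply/ler_addgt0Pr => e e0; rewrite add0r.
have e40 : 0 < e / 4 by rewrite divr_gt0.
have nb z : nbhs g [set k : X -> Y | mdist (g z) (k z) < e / 4].
  exact: (@proj_continuous _ (fun _ => Y) z g _ (nbhs_mdist (g z) e40)).
pose A := [set k : X -> Y |
  forall y y', `|mdist y y' - mdist (k y) (k y')| <= e / 4].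
have FA : (f @ \oo) A.
  have := near_infty_natSinv_lt (PosNum e40); apply: filterS => n /= ne y y'.
  by rewrite (le_trans (fP n y y'))// ltW.
have [k [Ak [kx kx']]] := clg _ _ FA (filterI (nb x) (nb x')).
have := Ak x x'; rewrite !ler_norml => /andP[].
have := metric_triangle (g x) (k x) (g x').
have := metric_triangle (k x) (k x') (g x').
have := metric_triangle (k x) (g x) (k x').
have := metric_triangle (g x) (g x') (k x').
rewrite (metric_sym (k x) (g x)) (metric_sym (k x') (g x')).
move: kx kx' => /= kx kx' h1 h2 h3 h4 h5 h6; apply/andP; split; lra.
Qed.

(** Each space embeds isometrically in the other; the self-embedding [f \o g] is onto by
    compactness, hence so is [f]. *)
Lemma gh_dist0_isometric X Y :
  (forall e : R, 0 < e -> (gh_dist X Y < e%:E)%E) -> isometric X Y.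
Proof.
move=> h; have [f fi] := gh_dist0_isometric_embedding h.
have [|g gi] := @gh_dist0_isometric_embedding Y X.
  by move=> e e0; rewrite gh_dist_sym; exact: h.
exists f => //.
have finj : injective f.
  by move=> x y fxy; apply: mdist_positivity; rewrite -fi fxy mdistxx.
have fgi : is_isometric_embedding (f \o g) by move=> a b /=; rewrite fi gi.
have /choice[f' f'K] y : exists x, f x = y.
  have [z zy] := isometric_self_embedding_surj compact_metric_compact fgi y.
  by exists (g z).
by exists f' => // x; apply: finj; rewrite f'K.
Qed.

End gromov_hausdorff.

(** * The topology of the space of isometry classes *)

Section gh_topology.
Context {R : realType}.
Implicit Types (X Y : compactMetricType R) (c : gh_space R).

Lemma iso_class_eq X Y : iso_class X = iso_class Y <-> isometric X Y.
Proof.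
split=> [/eqP|XY]; first by rewrite eqmodE => /asboolP.
by apply/eqP; rewrite eqmodE; apply/asboolP.
Qed.

Lemma iso_class_repr c : iso_class (gh_repr c) = c.
Proof. exact: reprK. Qed.

Lemma gh_dist_repr X (e : R) : 0 < e ->
  (gh_dist (gh_repr (iso_class X)) X < e%:E)%E.
Proof.
by move=> e0; apply: isometric_gh_dist => //; apply/iso_class_eq/iso_class_repr.
Qed.

Lemma gh_ball_nbhs c (e : R) : 0 < e ->
  nbhs c [set c' | (gh_dist (gh_repr c) (gh_repr c') < e%:E)%E].
Proof.
move=> e0; pose near c' (d : R) :=
  (gh_dist (gh_repr c) (gh_repr c') < d%:E)%E.
apply: open_nbhs_nbhs; split; last first.
  by apply: isometric_gh_dist => //; exists id => //; exists id.
suff : gh_open [set c' | near c' e] by [].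
move=> c' /= cc'.
have [x _] := @compact_metric_nonempty R (gh_repr c).
have t0 : (0 <= gh_dist (gh_repr c) (gh_repr c'))%E by exact: gh_dist_ge0.
pose t := fine (gh_dist (gh_repr c) (gh_repr c')).
have tE : gh_dist (gh_repr c) (gh_repr c') = t%:E.
  by rewrite fineK// ge0_fin_numE// (lt_trans cc')// ltry.
have te : t < e by rewrite -lte_fin -tE.
(* [gh_dist_triangle] turns strict bounds into a weak one: one third raises [t] to a strict bound,
   one third is the radius, and the last one restores strictness. *)
exists ((e - t) / 3); first by rewrite divr_gt0// subr_gt0.
move=> c'' c'c''; rewrite /near.
have h : (gh_dist (gh_repr c) (gh_repr c') < (t + (e - t) / 3)%:E)%E.
  by rewrite tE lte_fin; lra.
apply: (le_lt_trans (gh_dist_triangle _ h c'c'')); last by rewrite lte_fin; lra.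
by rewrite tE lee_fin in t0; lra.
Qed.

Lemma gh_hausdorff : hausdorff_space (gh_space R).
Proof.
move=> c c' cc'; rewrite -(iso_class_repr c) -(iso_class_repr c').
apply/iso_class_eq/gh_dist0_isometric => e e0.
have e30 : 0 < e / 3 by rewrite divr_gt0.
have [c'' [/= h h']] := cc' _ _ (gh_ball_nbhs c e30) (gh_ball_nbhs c' e30).
rewrite gh_dist_sym in h'.
apply: (le_lt_trans (gh_dist_triangle _ h h')); first by rewrite addr_gt0.
by rewrite lte_fin; lra.
Qed.

Lemma topological_embedding_compact (H : topologicalType) (S : set (gh_space R))
    (F : H -> S) :
  compact [set: H] -> injective F -> continuous (fun h => val (F h)) ->
  topological_embedding F.
Proof.
move=> cH Finj Fc; split=> //.
  by apply: continuous_comp_initial.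
move=> A oA.
pose K := (fun h => val (F h)) @` (~` A).
have cK : closed K.
  apply: compact_closed; first exact: gh_hausdorff.
  apply: continuous_compact; first exact: continuous_subspaceT.
  apply: (subclosed_compact _ cH) => //; exact: open_closedC.
exists (val @^-1` (~` K)).
  exists (~` K); [exact: closed_openC|by []].
apply/seteqP; split=> [_ [h Ah <-]|_ [[h _ <-]] /= nK].
  split; first by exists h.
  by move=> [h' nAh' /val_inj/Finj h'h]; apply: nAh'; rewrite h'h.
by exists h => //; apply: contrapT => nAh; apply: nK; exists h.
Qed.

Lemma iso_class_continuous (H : topologicalType) (F : H -> compactMetricType R) :
  (forall h (e : R), 0 < e -> nbhs h [set h' | (gh_dist (F h) (F h') < e%:E)%E]) ->
  continuous (fun h => iso_class (F h)).
Proof.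
move=> Fc h A; rewrite nbhsE => -[U [oU Uh] UA].
have [e e0 eU] := oU _ Uh.
(* Three fifths for the distance in the family and the two distances to the chosen representatives,
   two for the strictness lost in both uses of the triangle inequality. *)
have e50 : 0 < e / 5 by rewrite divr_gt0.
apply: filterS (Fc h _ e50) => h' /= hh'; apply: UA; apply: eU.
have h1 := gh_dist_repr (F h) e50; have h2 := gh_dist_repr (F h') e50.
rewrite gh_dist_sym in h2.
have := gh_dist_triangle _ h1 hh'; rewrite addr_gt0// => /(_ isT) h3.
have h4 : (gh_dist (gh_repr (iso_class (F h))) (F h') < (e / 5 * 3)%:E)%E.
  by apply: le_lt_trans h3 _; rewrite lte_fin; lra.
apply: (le_lt_trans (gh_dist_triangle _ h4 h2)); first lra.
by rewrite lte_fin; lra.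
Qed.

End gh_topology.

(** * Dimensions of a disjoint union of pieces *)

Section ereal_inf_real.
Context {R : realType}.
Implicit Types (P : R -> Prop) (a : \bar R).

(** The Hausdorff, packing and Assouad dimensions are infima of this shape. Testing only [s > 0]
    matters for [a = 0], since the condition may fail at [s = 0], where powers count points. *)
Lemma ereal_inf_real_le P a : (0 <= a)%E ->
  (forall s : R, 0 < s -> (a < s%:E)%E -> P s) ->
  (ereal_inf [set s%:E | s in [set s : R | (0 <= s)%R /\ P s]] <= a)%E.
Proof.
case: a => [a||]; rewrite ?lee_fin ?leey// => a0 aP.
apply/lee_addgt0Pr => e e0; apply: ge_ereal_inf; exists (a + e)%:E => //.
exists (a + e) => //; split; first by rewrite addr_ge0// ltW.
by apply: aP; rewrite ?lte_fin ?ltrDl// ltr_wpDl.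
Qed.

Lemma ereal_inf_real_lt P a (s : R) :
  (forall t u : R, 0 <= t -> t < u -> P t -> P u) ->
  (ereal_inf [set s%:E | s in [set s : R | (0 <= s)%R /\ P s]] <= a)%E ->
  (a < s%:E)%E -> P s.
Proof.
move=> Pup infa /(le_lt_trans infa)/ereal_inf_lt[_ [t [t0 Pt] <-]].
by rewrite lte_fin => ts; exact: Pup Pt.
Qed.

(** Serves to merge finitely many countable covers into one indexed by the naturals; a natural that
    codes no pair will carry the empty set, whence the value 0. *)
Lemma nneseries_pickle (I : finType) (c : I -> nat -> \bar R) :
  (forall i m, 0 <= c i m)%E ->
  (\sum_(0 <= k <oo)
     (if @pickle_inv (I * nat)%type k is Some p then c p.1 p.2 else 0) =
   \sum_i \sum_(0 <= m <oo) c i m)%E.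
Proof.
move=> c0; rewrite nneseries_esumT; last first.
  by move=> k; case: pickle_inv.
pose g (k : nat) := if @pickle_inv (I * nat)%type k is Some p
  then c p.1 p.2 else 0%E.
transitivity (\esum_(k in range (@pickle (I * nat)%type)) g k)%E.
  rewrite [RHS]esum_mkcond; apply: eq_esum => k _; rewrite /g.
  case: ifPn => // /negP kr.
  case: (pickle_inv k) (@pickle_invK (I * nat)%type k) => //= p pk.
  by case: kr; rewrite inE; exists p.
rewrite esum_image; last by move=> x y _ _; exact: (pcan_inj pickleK_inv).
rewrite (eq_esum (b := fun p => c p.1 p.2)); last first.
  by move=> p _; rewrite /g pickleK_inv.
transitivity (\esum_(p in [set: I] `*` [set: nat]) c p.1 p.2)%E.
  by congr esum; apply/seteqP; split.
rewrite -(@esum_esum _ _ _ setT (fun=> setT) (fun i m => c i m))//.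
rewrite esum_fset//; last by move=> i _; exact: esum_ge0.
rewrite [RHS]fsbig_seq ?index_enum_uniq//.
rewrite (_ : [set` index_enum I] = setT); last first.
  by apply/seteqP; split=> // i _; rewrite /= mem_index_enum.
  by apply: eq_fsbigr => i _; rewrite nneseries_esumT.
exact: finite_finset.
Qed.

End ereal_inf_real.

Lemma dependent_functional_choice (I : Type) (T : I -> Type)
    (P : forall i, T i -> Prop) :
  (forall i, exists x, P i x) -> exists f : forall i, T i, forall i, P i (f i).
Proof. by move=> h; exists (fun i => sval (cid (h i))) => i; exact: svalP. Qed.

(* Below the scale [delta], [W] is the disjoint union of the [Z i]. *)
Record decomposition (R : realType) (W : compactMetricType R) (I : finType)
    (Z : I -> compactMetricType R) (iota : forall i, Z i -> W) (delta : R) :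
    Prop := {
  decomposition_gt0 : 0 < delta ;
  decomposition_cover : forall w, exists i z, iota i z = w ;
  decomposition_le : forall i z z',
    mdist (iota i z) (iota i z') <= mdist z z' ;
  decomposition_eq : forall i z z', mdist (iota i z) (iota i z') < delta ->
    mdist (iota i z) (iota i z') = mdist z z' ;
  decomposition_sep : forall i j z z',
    mdist (iota i z) (iota j z') < delta -> i = j }.

Section null_sets.
Context {R : realType} {X : compactMetricType R}.
Implicit Types (s delta eta : R) (A : set X).
Local Open Scope ereal_scope.

Lemma diam_ge0 A : 0 <= diam A.
Proof. by apply: ereal_sup_ubound; left. Qed.

Lemma diamP A (t : \bar R) :
  diam A <= t <-> 0 <= t /\ (forall x y, A x -> A y -> (mdist x y)%:E <= t).
Proof.
split=> [At|[t0 At]].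
  split=> [|x y Ax Ay]; first exact: le_trans (diam_ge0 A) At.
  by apply: le_trans At; apply: ereal_sup_ubound; right; exists (x, y).
by apply: ge_ereal_sup => _ [->//|[[x y] [/= Ax Ay] <-]]; exact: At.
Qed.

Lemma mdist_le_diam A x y : A x -> A y -> (mdist x y)%:E <= diam A.
Proof. by have /diamP[_] := lexx (diam A); exact. Qed.

Lemma hausdorff_premeasure_ge0 s delta A : 0 <= hausdorff_premeasure s delta A.
Proof.
apply: le_ereal_inf_tmp => _ [F _ <-].
by apply: nneseries_ge0 => n _ _; exact: poweR_ge0.
Qed.

Lemma hausdorff_measure_ge0 s A : 0 <= hausdorff_measure s A.
Proof.
apply: le_ereal_sup_tmp; exists (hausdorff_premeasure s 1 A).
  by exists 1%R => /=.
exact: hausdorff_premeasure_ge0.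
Qed.

Lemma hausdorff_measure0P s A : hausdorff_measure s A = 0 <->
  forall delta eta, (0 < delta)%R -> (0 < eta)%R -> exists F : nat -> set X,
    [/\ A `<=` \bigcup_i F i, forall i, diam (F i) < delta%:E &
        \sum_(0 <= i <oo) poweR (diam (F i)) s < eta%:E].
Proof.
split=> [A0 delta eta delta0 eta0|AF].
  have : hausdorff_premeasure s delta A < eta%:E.
    apply: (@le_lt_trans _ _ (hausdorff_measure s A)); last by rewrite A0 lte_fin.
    by apply: ereal_sup_ubound; exists delta.
  by move=> /ereal_inf_lt[_ [F [AF dF] <-] Feta]; exists F.
apply/eqP; rewrite eq_le hausdorff_measure_ge0 andbT.
apply: ge_ereal_sup => _ [delta /= delta0 <-].
apply/lee_addgt0Pr => eta eta0; rewrite add0e.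
have [F [AF' dF /ltW Feta]] := AF delta eta delta0 eta0.
apply: ge_ereal_inf; exists (\sum_(0 <= i <oo) poweR (diam (F i)) s) => //.
by exists F.
Qed.

Lemma hausdorff_measure0_up A (s t : R) : (0 <= s)%R -> (s < t)%R ->
  hausdorff_measure s A = 0 -> hausdorff_measure t A = 0.
Proof.
move=> s0 st /hausdorff_measure0P As; apply/hausdorff_measure0P.
move=> delta eta delta0 eta0.
(* For diameters below 1, a larger exponent gives a smaller power. *)
have [|//|F [AF dF Feta]] := As (Num.min delta 1%R) eta; first by rewrite lt_min delta0/=.
exists F; split=> // [i|]; first by rewrite (lt_le_trans (dF i))// lee_fin ge_min lexx.
apply: le_lt_trans Feta; apply: lee_nneseries => [i _ _|i _]; first exact: poweR_ge0.
have := dF i; have := diam_ge0 (F i); case: (diam (F i)) => [d||//].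
- rewrite lee_fin lte_fin lt_min => d0 /andP[_ d1]; rewrite !poweR_EFin lee_fin.
  move: d0; rewrite le_eqVlt => /predU1P[<-|d0].
    by rewrite (powR0 (lt0r_neq0 (le_lt_trans s0 st))) powR_ge0.
  by rewrite ger_powR ?d0 ?ltW.
- by move=> _; rewrite ltNge leey.
Qed.

Lemma packing_premeasure_ge0 s delta A : 0 <= packing_premeasure s delta A.
Proof.
have [x _] := @compact_metric_nonempty _ X.
apply: le_ereal_sup_tmp; exists 0 => //.
exists set0, (fun=> x), (fun=> 0%R); by split=> //; rewrite esum_set0.
Qed.

Lemma packing_premeasure0_ge0 s A : 0 <= packing_premeasure0 s A.
Proof. by apply: le_ereal_inf_tmp => _ [d _ <-]; exact: packing_premeasure_ge0. Qed.

Lemma packing_measure_ge0 s A : 0 <= packing_measure s A.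
Proof.
apply: le_ereal_inf_tmp => _ [S _ <-].
by apply: nneseries_ge0 => n _ _; exact: packing_premeasure0_ge0.
Qed.

Lemma packing_measure0P s A : packing_measure s A = 0 <->
  forall eta, (0 < eta)%R -> exists2 S : nat -> set X, A `<=` \bigcup_i S i &
    \sum_(0 <= i <oo) packing_premeasure0 s (S i) < eta%:E.
Proof.
split=> [A0 eta eta0|AS].
  have : packing_measure s A < eta%:E by rewrite A0 lte_fin.
  by move=> /ereal_inf_lt[_ [S AS <-] Seta]; exists S.
apply/eqP; rewrite eq_le packing_measure_ge0 andbT.
apply/lee_addgt0Pr => eta eta0; rewrite add0e.
have [S AS' /ltW Seta] := AS eta eta0.
apply: ge_ereal_inf.
by exists (\sum_(0 <= i <oo) packing_premeasure0 s (S i)) => //; exists S.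
Qed.

Lemma packing_measure0_up A (s t : R) : (0 <= s)%R -> (s < t)%R ->
  packing_measure s A = 0 -> packing_measure t A = 0.
Proof.
move=> s0 st /packing_measure0P As; apply/packing_measure0P => eta eta0.
have [S AS Seta] := As eta eta0; exists S; first exact: AS.
apply: le_lt_trans Seta.
apply: lee_nneseries => [i _ _|i _]; first exact: packing_premeasure0_ge0.
apply: le_ereal_inf_tmp => _ [delta /= delta0 <-].
apply: ge_ereal_inf; exists (packing_premeasure t (Num.min delta 1%R) (S i)).
  by exists (Num.min delta 1%R) => //=; rewrite lt_min delta0/=.
apply: ge_ereal_sup => _ [I [x [r [Ax rd tr ->]]]].
apply: le_ereal_sup_tmp; exists (\esum_(i in I) (powR (r i) s)%:E).
  exists I, x, r; split=> // j /rd /andP[-> /=] /lt_le_trans; apply.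
  by rewrite ge_min lexx.
apply: le_esum => j /rd /andP[r0]; rewrite lt_min => /andP[_ r1].
by rewrite lee_fin ger_powR ?r0 ?ltW.
Qed.

End null_sets.

Section decomposition_measures.
Context {R : realType} (W : compactMetricType R) (I : finType).
Context (Z : I -> compactMetricType R) (iota : forall i, Z i -> W) (delta : R).
Arguments iota : clear implicits.
Hypothesis dec : decomposition iota delta.

Let delta0 : 0 < delta. Proof. exact: decomposition_gt0 dec. Qed.

Let distE i z z' : mdist (iota i z) (iota i z') < delta ->
  mdist (iota i z) (iota i z') = mdist z z'.
Proof. exact: decomposition_eq dec _ _ _. Qed.

Let dist_le i z z' : mdist (iota i z) (iota i z') <= mdist z z'.
Proof. exact: decomposition_le dec _ _ _. Qed.

Lemma decomposition_cball i (z : Z i) (r : R) : r < delta ->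
  cball (iota i z) r = iota i @` cball z r.
Proof.
move=> rd; apply/seteqP; split=> [w zw|_ [z' zz' <-]]; last first.
  exact: le_trans (dist_le z z') zz'.
have [j [z' wE]] := decomposition_cover dec w.
have ltd := le_lt_trans zw rd; rewrite -{}wE in zw ltd *.
have ij := decomposition_sep dec ltd; subst j.
by exists z' => //; rewrite /cball /= -distE.
Qed.

Local Open Scope ereal_scope.

(** Covers of [W] by sets of diameter below [delta] pull back without increasing diameters, as
    [iota i] preserves distances within such sets. *)
Lemma hausdorff_dim_le_decomposition i : hausdorff_dim (Z i) <= hausdorff_dim W.
Proof.
apply: ereal_inf_le_tmp => _ [s [s0 Ws] <-]; exists s => //; split=> //.
move/hausdorff_measure0P : Ws => Ws; apply/hausdorff_measure0P.
move=> epsilon eta epsilon0 eta0.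
have [|//|F [WF dF Feta]] := Ws (Num.min epsilon delta) eta.
  by rewrite lt_min epsilon0.
have FZ k : diam (iota i @^-1` F k) <= diam (F k).
  apply/diamP; split=> [|x y Fx Fy]; first exact: diam_ge0.
  have Fxy := @mdist_le_diam _ _ (F k) _ _ Fx Fy; rewrite -distE//.
  rewrite -lte_fin; apply: (le_lt_trans Fxy); apply: (lt_le_trans (dF k)).
  by rewrite lee_fin ge_min lexx orbT.
exists (fun k => iota i @^-1` F k); split.
- by move=> z _; have [k _ Fk] := WF (iota i z) Logic.I; exists k.
- move=> k; apply: (le_lt_trans (FZ k)); apply: (lt_le_trans (dF k)).
  by rewrite lee_fin ge_min lexx.
- apply: le_lt_trans Feta; apply: lee_nneseries => [k _ _|k _].
    exact: poweR_ge0.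
  by apply: gt0_ler_poweR; rewrite ?in_itv/= ?diam_ge0 ?leey.
Qed.

(** The maps [iota i] do not increase distances, so covers of the finitely many pieces can be pushed
    forward and merged. *)
Lemma decomposition_hausdorff_dim_le (a : \bar R) : 0 <= a ->
  (forall i, hausdorff_dim (Z i) <= a) -> hausdorff_dim W <= a.
Proof.
move=> a0 Za; apply: ereal_inf_real_le => // s s0 as0.
have Zs i : hausdorff_measure s [set: Z i] = 0.
  apply: ereal_inf_real_lt (Za i) as0 => t u t0 tu.
  exact: hausdorff_measure0_up.
apply/hausdorff_measure0P => epsilon eta epsilon0 eta0.
(* The [#|I|] errors add up to [eta * #|I| / #|I|.+1], strictly below [eta]. *)
have eta1 : (0 < eta / #|I|.+1%:R)%R by rewrite divr_gt0.
have /dependent_functional_choice[F FP] i : exists F : nat -> set (Z i),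
    [/\ [set: Z i] `<=` \bigcup_k F k, forall k, diam (F k) < epsilon%:E &
        \sum_(0 <= k <oo) poweR (diam (F k)) s < (eta / #|I|.+1%:R)%:E].
  by have /hausdorff_measure0P := Zs i; exact.
pose G k := if @pickle_inv (I * nat)%type k is Some p
  then iota p.1 @` F p.1 p.2 else set0.
have dG k : diam (G k) <= if @pickle_inv (I * nat)%type k is Some p
    then diam (F p.1 p.2) else 0.
  rewrite /G; case: pickle_inv => [[i m]/=|]; last first.
    by apply/diamP; split => // x y [].
  apply/diamP; split=> [|_ _ [x Fx <-] [y Fy <-]]; first exact: diam_ge0.
  by apply: le_trans (mdist_le_diam Fx Fy); rewrite lee_fin.
exists G; split.
- move=> w _; have [i [z <-]] := decomposition_cover dec w.
  have [+ _ _] := FP i => /(_ z Logic.I)[m _ Fz].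
  by exists (pickle (i, m)) => //; rewrite /G pickleK_inv; exists z.
- move=> k; apply: (le_lt_trans (dG k)); case: pickle_inv => [[i m]|//=].
    by have [_ + _] := FP i; exact.
- apply: (@le_lt_trans _ _ (\sum_i \sum_(0 <= m <oo) poweR (diam (F i m)) s)).
    rewrite -nneseries_pickle; last by move=> i m; exact: poweR_ge0.
    apply: lee_nneseries => [k _ _|k _]; first exact: poweR_ge0.
    have := dG k; case: pickle_inv => [[i m]/=|] dGk; last first.
      rewrite (_ : diam (G k) = 0) ?poweR0r ?gt_eqF//.
      by apply/eqP; rewrite eq_le dGk diam_ge0.
    by apply: gt0_ler_poweR; rewrite ?in_itv/= ?diam_ge0 ?leey// ltW.
  apply: (@le_lt_trans _ _ (\sum_(i : I) (eta / #|I|.+1%:R)%:E)).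
    by apply: lee_sum => i _; have [_ _ /ltW] := FP i.
  rewrite sumEFin lte_fin sumr_const -[ltLHS]mulr_natl mulrCA gtr_pMr//.
  by rewrite ltr_pdivrMr// mul1r ltr_nat.
Qed.

(** The balls of a packing are taken in the whole space. A ball of [W] of radius below [delta] does
    not leave the piece of its center, so disjoint balls of [Z i] remain disjoint in [W]. *)
Lemma packing_dim_le_decomposition i : packing_dim (Z i) <= packing_dim W.
Proof.
apply: ereal_inf_le_tmp => _ [s [s0 Ws] <-]; exists s => //; split=> //.
move/packing_measure0P : Ws => Ws; apply/packing_measure0P => eta eta0.
have [S WS Seta] := Ws eta eta0; exists (fun k => iota i @^-1` S k).
  by move=> z _; have [k _ Sk] := WS (iota i z) Logic.I; exists k.
apply: le_lt_trans Seta; apply: lee_nneseries => [k _ _|k _].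
  exact: packing_premeasure0_ge0.
apply: le_ereal_inf_tmp => _ [epsilon /= epsilon0 <-].
apply: ge_ereal_inf; pose d := Num.min epsilon delta.
exists (packing_premeasure s d (iota i @^-1` S k)).
  by exists d => //=; rewrite lt_min epsilon0.
apply: ge_ereal_sup => _ [J [x [r [Sx rd tr ->]]]].
apply: ereal_sup_ubound; exists J, (fun j => iota i (x j)), r; split=> //.
- by move=> j /rd /andP[-> /=]; rewrite lt_min => /andP[].
- have rdelta j : J j -> (r j < delta)%R.
    by move=> /rd /andP[_]; rewrite lt_min => /andP[].
  move=> j k' Jj Jk' [w []]; rewrite !decomposition_cball ?rdelta//.
  move=> [z zj <-] [z' zk' zz']; apply: tr => //; exists z; split=> //.
  suff -> : z = z' by [].
  by apply: mdist_positivity; rewrite -distE zz' mdistxx.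
Qed.

(** Here disjointness is carried from [W] to the pieces: [iota i] does not increase distances, so a
    common point of two balls of [Z i] gives one in [W]. *)
Lemma decomposition_packing_dim_le (a : \bar R) : 0 <= a ->
  (forall i, packing_dim (Z i) <= a) -> packing_dim W <= a.
Proof.
move=> a0 Za; apply: ereal_inf_real_le => // s s0 as0.
have Zs i : packing_measure s [set: Z i] = 0.
  apply: ereal_inf_real_lt (Za i) as0 => t u t0 tu.
  exact: packing_measure0_up.
apply/packing_measure0P => eta eta0.
have eta1 : (0 < eta / #|I|.+1%:R)%R by rewrite divr_gt0.
have /dependent_functional_choice[S SP] i : exists S : nat -> set (Z i),
    [set: Z i] `<=` \bigcup_k S k /\
    \sum_(0 <= k <oo) packing_premeasure0 s (S k) < (eta / #|I|.+1%:R)%:E.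
  by have /packing_measure0P/(_ _ eta1)[S] := Zs i; exists S.
pose T k := if @pickle_inv (I * nat)%type k is Some p
  then iota p.1 @` S p.1 p.2 else set0.
exists T.
  move=> w _; have [i [z <-]] := decomposition_cover dec w.
  have [+ _] := SP i => /(_ z Logic.I)[m _ Sz].
  by exists (pickle (i, m)) => //; rewrite /T pickleK_inv; exists z.
apply: (@le_lt_trans _ _
    (\sum_i \sum_(0 <= m <oo) packing_premeasure0 s (S i m))).
  rewrite -nneseries_pickle; last by move=> i m; exact: packing_premeasure0_ge0.
  apply: lee_nneseries => [k _ _|k _]; first exact: packing_premeasure0_ge0.
  rewrite /T; case: pickle_inv => [[i m]/=|]; last first.
    apply: ge_ereal_inf; exists (packing_premeasure s 1 (@set0 W)).
      by exists 1%R => /=.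
    apply: ge_ereal_sup => _ [J [x [r [Sx _ _ ->]]]].
    by rewrite (_ : J = set0) ?esum_set0// -subset0 => j /Sx.
  apply: le_ereal_inf_tmp => _ [epsilon /= epsilon0 <-].
  apply: ge_ereal_inf; exists (packing_premeasure s epsilon (iota i @` S i m)).
    by exists epsilon.
  apply: ge_ereal_sup => _ [J [x [r [Sx rd tr ->]]]].
  have [z0 _] := @compact_metric_nonempty _ (Z i).
  have /choice[z zP] j : exists z, J j -> S i m z /\ iota i z = x j.
    have [Jj|nJj] := pselect (J j); last by exists z0.
    by have [z Sz zx] := Sx j Jj; exists z.
  apply: ereal_sup_ubound; exists J, z, r; split=> //.
    by move=> j /zP[].
  move=> j k' Jj Jk' [y [yj yk']]; apply: tr => //.
  have [_ <-] := zP j Jj; have [_ <-] := zP k' Jk'.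
  exists (iota i y); split; first exact: le_trans (dist_le _ _) yj.
  exact: le_trans (dist_le _ _) yk'.
apply: (@le_lt_trans _ _ (\sum_(i : I) (eta / #|I|.+1%:R)%:E)).
  by apply: lee_sum => i _; have [_ /ltW] := SP i.
rewrite sumEFin lte_fin sumr_const -[ltLHS]mulr_natl mulrCA gtr_pMr//.
by rewrite ltr_pdivrMr// mul1r ltr_nat.
Qed.

End decomposition_measures.

Lemma ereal_le_real (R : realType) (x a : \bar R) : (0 <= a)%E ->
  (forall s : R, 0 < s -> (a < s%:E)%E -> (x <= s%:E)%E) -> (x <= a)%E.
Proof.
case: a => [a||]; rewrite ?lee_fin ?leey// => a0 ax.
apply/lee_addgt0Pr => e e0; apply: ax; last by rewrite lte_fin ltrDl.
by rewrite ltr_wpDl.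
Qed.

(** * Covering dimension of a disjoint union *)

Section open_metric.
Context {R : realType} {X : metricType R}.

Lemma mdist_open (A : set X) :
  (forall x, A x -> exists2 e : R, 0 < e & [set y | mdist x y < e] `<=` A) ->
  open A.
Proof.
move=> hA; rewrite openE => x /hA[e e0 eA].
exact: filterS eA (nbhs_mdist x e0).
Qed.

Lemma open_mdist (A : set X) x : open A -> A x ->
  exists2 e : R, 0 < e & [set y | mdist x y < e] `<=` A.
Proof. by move=> oA Ax; apply: mdist_nbhs; exact: open_nbhs_nbhs. Qed.

End open_metric.

Lemma covering_dim_le_up (T : topologicalType) (m n : nat) : (m <= n)%N ->
  covering_dim_le T m -> covering_dim_le T n.
Proof.
move=> mn Tm U fU oU cU; have [V [fV oV cV VU Vm]] := Tm U fU oU cU.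
exists V; split=> // x; apply: card_le_trans (Vm x) _.
by apply: subset_card_le => k /= /leq_trans; exact.
Qed.

Lemma topological_dim_le (R : realType) (T : topologicalType) (a : \bar R) :
  (topological_dim R T <= a)%E -> forall s : R, (a < s%:E)%E ->
  exists2 n : nat, n%:R < s & covering_dim_le T n.
Proof.
move=> Ta s as0; have /ereal_inf_lt[_ [n Tn <-]] := le_lt_trans Ta as0.
by rewrite lte_fin; exists n.
Qed.

Section decomposition_topology.
Context {R : realType} (W : compactMetricType R) (I : finType).
Context (Z : I -> compactMetricType R) (iota : forall i, Z i -> W) (delta : R).
Arguments iota : clear implicits.
Hypothesis dec : decomposition iota delta.

Let delta0 : 0 < delta. Proof. exact: decomposition_gt0 dec. Qed.

Let distE i z z' : mdist (iota i z) (iota i z') < delta ->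
  mdist (iota i z) (iota i z') = mdist z z'.
Proof. exact: decomposition_eq dec _ _ _. Qed.

Let dist_le i z z' : mdist (iota i z) (iota i z') <= mdist z z'.
Proof. exact: decomposition_le dec _ _ _. Qed.

Lemma decomposition_near i z w : mdist (iota i z) w < delta ->
  exists2 z', iota i z' = w & mdist z z' = mdist (iota i z) w.
Proof.
have [j [z' <-]] := decomposition_cover dec w => zz'.
have ij := decomposition_sep dec zz'; subst j.
by exists z' => //; rewrite distE.
Qed.

Lemma decomposition_inj i : injective (iota i).
Proof.
move=> z z' zz'; apply: mdist_positivity.
by rewrite -distE zz' mdistxx.
Qed.

Lemma decomposition_preimage_open i (A : set W) :
  open A -> open (iota i @^-1` A).
Proof.
move=> oA; apply: mdist_open => z /(open_mdist oA)[e e0 eA].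
by exists e => // z' zz'; apply: eA; exact: le_lt_trans zz'.
Qed.

Lemma decomposition_image_open i (A : set (Z i)) :
  open A -> open (iota i @` A).
Proof.
move=> oA; apply: mdist_open => _ [z Az <-].
have [e e0 eA] := open_mdist oA Az.
exists (Num.min e delta); first by rewrite lt_min e0.
move=> w /=; rewrite lt_min => /andP[zw] /decomposition_near[z' z'w zz'].
by exists z' => //; apply: eA; rewrite /= zz'.
Qed.

Lemma decomposition_range_closed i : open (~` range (iota i)).
Proof.
apply: mdist_open => w nw; exists delta => // w' ww' [z _ zw']; apply: nw.
have [|z' <- _] := @decomposition_near i z w; first by rewrite zw' metric_sym.
by exists z'.
Qed.

Lemma covering_dim_le_decomposition i n :
  covering_dim_le W n -> covering_dim_le (Z i) n.
Proof.
move=> Wn U fU oU cU.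
(* The range of [iota i] is open and closed, so its complement completes the images of the members
   of [U] to an open cover of [W]. *)
pose U' := (fun A => iota i @` A) @` U `|` [set ~` range (iota i)].
have [|||V [fV oV cV VU Vn]] := Wn U'.
- by rewrite finite_setU; split; [exact: finite_image|exact: finite_set1].
- move=> _ [[A UA <-]|->]; last exact: decomposition_range_closed.
  exact/decomposition_image_open/oU.
- rewrite -subTset => w _.
  have [[z _ <-]|nw] := pselect (range (iota i) w); last first.
    by exists (~` range (iota i)) => //; right.
  have : (\bigcup_(A in U) A) z by rewrite cU.
  move=> [A UA Az]; exists (iota i @` A); last by exists z.
  by left; exists A.
exists ((fun B => iota i @^-1` B) @` V); split.
- exact: finite_image.
- by move=> _ [B /oV oB <-]; exact: decomposition_preimage_open.
- rewrite -subTset => z _; have : (\bigcup_(B in V) B) (iota i z) by rewrite cV.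
  by move=> [B VB Bz]; exists (iota i @^-1` B) => //; exists B.
- move=> _ [B VB <-]; have [A [[A' UA' <-]|->] BA] := VU B VB.
    exists A' => // z /BA[z' A'z' /decomposition_inj <-//].
  (* This [B] avoids the piece and has empty preimage; any member of [U] contains it, and [z0]
     provides a member. *)
  have [z0 _] := @compact_metric_nonempty _ (Z i).
  have : (\bigcup_(A in U) A) z0 by rewrite cU.
  move=> [A' UA' _]; exists A' => // z /BA /=.
  by case; exists z.
- move=> z; apply: card_le_trans _ (Vn (iota i z)).
  apply: (card_le_trans _ (card_image_le (fun B => iota i @^-1` B) _)).
  by apply: subset_card_le => _ [[B VB <-] Bz]; exists B.
Qed.

(** The pieces are disjoint, so a point of [W] lies only in members of the refinement chosen for its
    own piece, and the order does not grow. *)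
Lemma decomposition_covering_dim_le n :
  (forall i, covering_dim_le (Z i) n) -> covering_dim_le W n.
Proof.
move=> Zn U fU oU cU.
have /dependent_functional_choice[V VP] i : exists V : set (set (Z i)),
    [/\ finite_set V, V `<=` open, \bigcup_(B in V) B = setT,
        forall B, V B -> exists2 A, U A & iota i @` B `<=` A &
        forall x, ([set B | V B /\ B x] #<= `I_n.+1)%card].
  have [|||V [fV oV cV VU Vn]] := Zn i ((fun B => iota i @^-1` B) @` U).
  - exact: finite_image.
  - by move=> _ [A /oU oA <-]; exact: decomposition_preimage_open.
  - rewrite -subTset => z _; have : (\bigcup_(A in U) A) (iota i z) by rewrite cU.
    by move=> [A UA Az]; exists (iota i @^-1` A) => //; exists A.
  exists V; split=> // B /VU[_ [A UA <-] BA].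
  by exists A => // _ [z /BA Az <-].
exists (\bigcup_i (fun B => iota i @` B) @` V i); split.
- apply: bigcup_finite; first exact: finite_finset.
  by move=> i _; apply: finite_image; have [] := VP i.
- move=> _ [i _ [B VB <-]]; apply: decomposition_image_open.
  by have [_ + _ _ _] := VP i; exact.
- rewrite -subTset => w _; have [i [z <-]] := decomposition_cover dec w.
  have [_ _ Vi _ _] := VP i; have : (\bigcup_(B in V i) B) z by rewrite Vi.
  move=> [B VB Bz]; exists (iota i @` B); last by exists z.
  by exists i => //; exists B.
- by move=> _ [i _ [B VB <-]]; have [_ _ _ + _] := VP i; exact.
- move=> w; have [i [z <-]] := decomposition_cover dec w.
  have [_ _ _ _ /(_ z)] := VP i; apply: card_le_trans.
  apply: (card_le_trans _ (card_image_le (fun B => iota i @` B) _)).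
  apply: subset_card_le => _ [[j _ [B VB <-]] [z' Bz' zz']].
  have ij : j = i by apply: (decomposition_sep dec (z := z') (z' := z)); rewrite zz' mdistxx.
  subst j; exists B => //; split=> //.
  by rewrite -(decomposition_inj zz').
Qed.

Lemma topological_dim_le_decomposition i :
  (topological_dim R (Z i) <= topological_dim R W)%E.
Proof.
apply: ereal_inf_le_tmp => _ [n Wn <-]; exists n => //.
exact: covering_dim_le_decomposition.
Qed.

Lemma decomposition_topological_dim_le (a : \bar R) : (0 <= a)%E ->
  (forall i, (topological_dim R (Z i) <= a)%E) -> (topological_dim R W <= a)%E.
Proof.
move=> a0 Za; apply: ereal_le_real => // s s0 as0.
have /choice[n nP] i : exists n : nat, n%:R < s /\ covering_dim_le (Z i) n.
  by have [n] := topological_dim_le (Za i) as0; exists n.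
apply: ge_ereal_inf; exists (\max_i n i)%:R%:E.
  exists (\max_i n i)%N => //; apply: decomposition_covering_dim_le => i.
  by apply: covering_dim_le_up (nP i).2; exact: leq_bigmax.
rewrite lee_fin; apply: (big_ind (fun k : nat => k%:R <= s)).
- exact: ltW.
- by move=> k l ks ls; rewrite /maxn; case: ifP.
- by move=> i _; exact: ltW (nP i).1.
Qed.

End decomposition_topology.

(** * Covering numbers, upper box and Assouad dimension *)

Section covering.
Context {R : realType} {X : compactMetricType R}.
Implicit Types (S : set X) (r t : R) (s : seq X).

(** Lists with possible repetitions can be mapped, filtered and concatenated; [covering_numberP]
    returns to sets of exact cardinality. *)
Definition covers S r s :=
  (forall x, x \in s -> S x) /\ (forall y, S y -> exists2 x, x \in s & mdist x y <= r).

Lemma covering_numberP S r t :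
  (covering_number S r <= t%:E)%E <-> exists2 s, covers S r s & (size s)%:R <= t.
Proof.
split=> [Nt|[s [sS cs] st]]; last first.
  apply: ge_ereal_inf; exists (size (undup s))%:R%:E; last first.
    by rewrite lee_fin (le_trans _ st)// ler_nat size_undup.
  exists (size (undup s)) => //; exists [set` [fset x in s]%fset]; split.
  - by move=> x /=; rewrite inE => /sS.
  - apply/card_eq_fsetP/eqP; rewrite -uniq_size_uniq ?undup_uniq ?fset_uniq//.
    by move=> x; rewrite mem_undup !inE.
  - by move=> y /cs[x xs xy]; exists x => //=; rewrite inE.
have t0 : 0 <= t.
  rewrite -lee_fin (le_trans _ Nt)//; apply: le_ereal_inf_tmp => _ [k _ <-].
  by rewrite lee_fin.
have : (covering_number S r < (Num.truncn t).+1%:R%:E)%E.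
  by apply: le_lt_trans Nt _; rewrite lte_fin truncnS_gt.
move=> /ereal_inf_lt[_ [k [A [AS Ak SA]] <-]]; rewrite lte_fin ltr_nat ltnS => kt.
have Afin : finite_set A by exists k.
exists (enum_fset (fset_set A)).
  have memA x : (x \in enum_fset (fset_set A)) = (x \in A).
    by rewrite -in_fset_set.
  split=> [x|y /SA[x Ax xy]]; first by rewrite memA => /set_mem/AS.
  by exists x => //; rewrite memA; exact: mem_set.
rewrite (card_fset_set Ak) (@le_trans _ _ (Num.truncn t)%:R)// ?ler_nat//.
by rewrite truncn_le.
Qed.

(** Centers have to lie in [S]. A center within [r] of a point of [S] is replaced by such a point,
    which at most doubles the radius; the other centers cover no point of [S]. *)
Lemma covers_subset S r t s : r + r <= t -> covers setT r s ->
  exists2 s', covers S t s' & (size s' <= size s)%N.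
Proof.
move=> rt [_ cs].
have /choice[p pP] x : exists z,
    (exists2 y, S y & mdist x y <= r) -> S z /\ mdist x z <= r.
  have [[y Sy xy]|n] := pselect (exists2 y, S y & mdist x y <= r).
    by exists y.
  by exists x.
exists [seq p x | x <- s & `[< exists2 y, S y & mdist x y <= r >]]; last first.
  by rewrite size_map size_filter count_size.
split=> [_ /mapP[x + ->]|y Sy].
  by rewrite mem_filter => /andP[/asboolP /pP[]].
have [x xs xy] := cs y Logic.I.
have ex : exists2 y, S y & mdist x y <= r by exists y.
exists (p x).
  by apply: map_f; rewrite mem_filter xs andbT; exact/asboolP.
have [_ xpx] := pP x ex; apply: le_trans (metric_triangle _ x _) _.
by rewrite (le_trans _ rt)// lerD// metric_sym.
Qed.

Lemma covers_exists r : 0 < r -> exists s, covers setT r s.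
Proof.
move=> r0; have [s sP] := finite_net compact_metric_compact (@nbhs_mdist R X) r0.
by exists s; split=> // y _; have [x xs /ltW] := sP y; exists x.
Qed.

Lemma metric_bounded : exists2 M : R, 0 < M & forall x y : X, mdist x y <= M.
Proof.
have [s [_ sP]] := covers_exists ltr01.
have [x0 _] := @compact_metric_nonempty _ X.
pose M := \sum_(x <- s) mdist x x0.
have xM x : mdist x x0 <= M + 1.
  have [z zs zx] := sP x Logic.I.
  have zM : mdist z x0 <= M.
    by rewrite /M (big_rem z)//= lerDl sumr_ge0// => i _; exact: mdist_ge0.
  have := metric_triangle x z x0; rewrite (metric_sym x z) => h.
  by rewrite (le_trans h)// addrC lerD.
have M0 : 0 <= M by apply: sumr_ge0 => i _; exact: mdist_ge0.
exists (M + 1 + (M + 1)) => [|x y]; first by lra.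
by apply: le_trans (metric_triangle _ x0 _) _; rewrite lerD// metric_sym.
Qed.

Lemma covering_number_ge0 S r : (0 <= covering_number S r)%E.
Proof. by apply: le_ereal_inf_tmp => _ [k _ <-]; rewrite lee_fin. Qed.

Lemma covering_number_ge1 r : (1 <= covering_number [set: X] r)%E.
Proof.
apply: le_ereal_inf_tmp => _ [[|k] [A [_ A0 cA]] <-]; last first.
  by rewrite lee_fin ler1n.
have [x0 _] := @compact_metric_nonempty _ X.
have [y + _] := cA x0 Logic.I.
by move: A0; rewrite II0 card_eq0 => /eqP ->.
Qed.

End covering.

(** Used to absorb a constant [K] for small [r]; at the threshold chosen, the power equals
    [|K| + 1]. *)
Lemma powRN_ge (R : realType) (K c : R) : 0 < c ->
  exists2 r1 : R, 0 < r1 & forall r, 0 < r -> r < r1 -> K <= r `^ (- c).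
Proof.
move=> c0; have K0 : 0 < `|K| + 1 by rewrite ltr_wpDl.
exists ((`|K| + 1) `^ (- c^-1)); first exact: powR_gt0.
move=> r r0 rr1; apply: le_trans (ler_norm K) _; apply: (@le_trans _ _ (`|K| + 1)).
  by rewrite lerDl.
rewrite powRN -[leLHS]invrK lef_pV2 ?posrE ?invr_gt0 ?powR_gt0//.
apply: (@le_trans _ _ (((`|K| + 1) `^ (- c^-1)) `^ c)).
  by apply: ge0_ler_powR; rewrite ?nnegrE ?powR_ge0 ?ltW.
by rewrite -powRrM mulNr mulVf ?lt0r_neq0// powR_inv1 ?(ltW K0).
Qed.

Lemma powR_div (R : realType) (x y s : R) : 0 <= x -> 0 < y ->
  (x / y) `^ s = x `^ s * y `^ (- s).
Proof.
move=> x0 y0; rewrite powRM ?invr_ge0 ?(ltW y0)//; congr (_ * _).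
by rewrite -(powR_inv1 (ltW y0)) -powRrM mulN1r.
Qed.

Section box_assouad.
Context {R : realType} (X : compactMetricType R).

Lemma box_ratioE (r s : R) : 0 < r < 1 ->
  (lne (covering_number [set: X] r) * (- ln r)^-1%:E <= s%:E)%E =
  (covering_number [set: X] r <= (r `^ (- s))%:E)%E.
Proof.
move=> /andP[r0 r1]; have L0 : 0 < - ln r by rewrite oppr_gt0 ln_lt0// r0.
rewrite lee_pdivrMr// -EFinM.
rewrite (_ : s * - ln r = ln (r `^ (- s))); last by rewrite ln_powR mulrN mulNr.
rewrite -lne_EFin ?powR_gt0// lee_lne// in_itv/= leey andbT.
  exact: covering_number_ge0.
by rewrite lee_fin powR_ge0.
Qed.

Lemma upper_box_dim_leP (a : \bar R) : (0 <= a)%E ->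
  (upper_box_dim X <= a)%E <->
  (forall s : R, 0 < s -> (a < s%:E)%E -> exists2 r0 : R, 0 < r0 &
    forall r, 0 < r -> r < r0 -> (covering_number [set: X] r <= (r `^ (- s))%:E)%E).
Proof.
move=> a0; split=> [Xa s s0 as0|Xa].
  have /ereal_inf_lt[_ [V V0 <-] Vs] := le_lt_trans Xa as0.
  have [e /= e0 eV] := V0.
  exists (Num.min e 1); first by rewrite lt_min e0 ltr01.
  move=> r r0; rewrite lt_min => /andP[re r1]; rewrite -box_ratioE ?r0//.
  rewrite (le_trans _ (ltW Vs))//; apply: ereal_sup_ubound; exists r => //.
  by apply: eV => //=; rewrite sub0r normrN gtr0_norm.
apply: ereal_le_real => // s s0 as0; have [r0 r00 r0P] := Xa s s0 as0.
apply: ge_ereal_inf; exists (ereal_sup ((fun r =>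
    (lne (covering_number [set: X] r) * (- ln r)^-1%:E)%E) @` `]0, (Num.min r0 1)[%classic)).
  exists `]0, (Num.min r0 1)[%classic => //.
  exists (Num.min r0 1) => /=; first by rewrite lt_min r00 ltr01.
  move=> r /=; rewrite sub0r normrN => rr r'0; rewrite in_itv/= r'0/=.
  by rewrite gtr0_norm in rr.
apply: ge_ereal_sup => _ [r + <-]; rewrite /= in_itv/= lt_min.
move=> /and3P[r'0 rr0 r1]; rewrite box_ratioE ?r'0//; exact: r0P.
Qed.

Lemma upper_box_dim_ge0 : (0 <= upper_box_dim X)%E.
Proof.
apply: le_ereal_inf_tmp => _ [V V0 <-]; have [e /= e0 eV] := V0.
pose r := Num.min e 1 / 2.
have m0 : 0 < Num.min e 1 by rewrite lt_min e0 ltr01.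
have r0 : 0 < r by rewrite divr_gt0.
have : r < Num.min e 1 by rewrite /r; lra.
rewrite lt_min => /andP[re r1].
apply: le_ereal_sup_tmp.
exists (lne (covering_number [set: X] r) * (- ln r)^-1%:E)%E.
  by exists r => //; apply: eV => //=; rewrite sub0r normrN gtr0_norm.
apply: mule_ge0; first by rewrite lne_ge0 covering_number_ge1.
by rewrite lee_fin invr_ge0 oppr_ge0 ln_le0// ltW.
Qed.

Definition assouad_bound (lambda : R) := 0 < lambda /\ exists2 C : R, 0 < C &
  forall (x : X) (r rho : R), 0 < r < rho ->
    (covering_number (cball x rho) r <= (C * (rho / r) `^ lambda)%:E)%E.

Lemma assouad_dimE : assouad_dim X =
  ereal_inf [set s%:E | s in [set s : R | 0 <= s /\ assouad_bound s]].
Proof.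
rewrite /assouad_dim; congr ereal_inf; congr image; apply/seteqP; split=> [s|s].
  by move=> [s0 sP]; split=> //; exact: ltW.
by move=> [_ [s0 sP]].
Qed.

Lemma assouad_bound_up (s t : R) : 0 <= s -> s < t ->
  assouad_bound s -> assouad_bound t.
Proof.
move=> s0 st [s1 [C C0 CP]]; split; first exact: lt_trans st.
exists C => // x r rho /[dup] /andP[r0 rrho] /CP/le_trans; apply.
by rewrite lee_fin ler_pM2l// ler_powR ?(ltW st)// ler_pdivlMr// mul1r ltW.
Qed.

(* For radii [rho >= delta], a cover of the ball comes from a cover of the whole
   space at scale [min r delta / 2]. *)
Lemma assouad_bound_local (delta s : R) : 0 < delta -> 0 < s ->
  assouad_bound s <-> exists2 C : R, 0 < C &
    (forall (x : X) (r rho : R), 0 < r < rho -> rho < delta ->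
      (covering_number (cball x rho) r <= (C * (rho / r) `^ s)%:E)%E) /\
    (forall r, 0 < r -> r < delta ->
      (covering_number [set: X] r <= (C * r `^ (- s))%:E)%E).
Proof.
move=> delta0 s0; split=> [[_ [C C0 CP]]|[C C0 [CP CX]]].
  have [M M0 MP] := @metric_bounded R X.
  have [x0 _] := @compact_metric_nonempty _ X.
  (* Large enough for a ball of radius [L] to be the whole space, and larger than every
     [r < delta]. *)
  pose L := M + delta.
  exists (C + C * L `^ s); first by rewrite ltr_wpDr// mulr_ge0 ?powR_ge0 ?ltW.
  split=> [x r rho rrho _|r r0 rd].
    apply: le_trans (CP x r rho rrho) _.
    by rewrite lee_fin ler_wpM2r ?powR_ge0// lerDl mulr_ge0 ?powR_ge0 ?ltW.
  have -> : [set: X] = cball x0 L.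
    apply/seteqP; split=> // x _; rewrite /cball /= (le_trans (MP _ _))//.
    by rewrite lerDl ltW.
  apply: le_trans (CP x0 r L _) _; first by rewrite r0 /L; lra.
  rewrite lee_fin powR_div ?addr_ge0 ?(ltW M0) ?(ltW delta0)// mulrA.
  by rewrite ler_wpM2r ?powR_ge0// lerDr ltW.
split=> //; exists (C + C * (2 / delta) `^ s).
  by rewrite ltr_wpDr// mulr_ge0 ?powR_ge0 ?ltW.
move=> x r rho /[dup] rrho /andP[r0 rrho']; have [rd|dr] := ltP rho delta.
  apply: le_trans (CP x r rho rrho rd) _.
  by rewrite lee_fin ler_wpM2r ?powR_ge0// lerDl mulr_ge0 ?powR_ge0 ?ltW.
have m0 : 0 < Num.min r delta by rewrite lt_min r0.
have h0 : 0 < Num.min r delta / 2 by rewrite divr_gt0.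
have hd : Num.min r delta / 2 < delta.
  have : Num.min r delta <= delta by rewrite ge_min lexx orbT.
  lra.
have /covering_numberP[u cu ut] := CX _ h0 hd.
have [|u' cu' uu'] := @covers_subset _ _ (cball x rho) _ r _ _ cu.
  by rewrite -splitr ge_min lexx.
apply/covering_numberP; exists u' => //.
apply: le_trans (_ : (size u)%:R <= _); first by rewrite ler_nat.
apply: (le_trans ut).
apply: (@le_trans _ _ (C * ((2 / delta) * (rho / r)) `^ s)); last first.
  rewrite (powRM _ (x := 2 / delta)) ?divr_ge0 ?(ltW delta0) ?(ltW r0)//.
    by rewrite mulrA ler_wpM2r ?powR_ge0// lerDr ltW.
  exact: ltW (lt_trans r0 rrho').
have rho0 : 0 < rho by exact: lt_trans rrho'.
rewrite ler_pM2l//.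
have -> : (Num.min r delta / 2) `^ (- s) = (1 / (Num.min r delta / 2)) `^ s.
  by rewrite (powR_div _ (x := 1))// powR1 mul1r.
apply: ge0_ler_powR; rewrite ?nnegrE ?(ltW s0)//.
- by rewrite divr_ge0 ?(ltW h0).
- by rewrite mulr_ge0// divr_ge0 ?(ltW delta0) ?(ltW r0) ?(ltW rho0).
(* Clearing denominators leaves [delta * r <= Num.min r delta * rho], which follows from
   [delta <= rho] or from [r <= rho], according to the minimum. *)
rewrite mulf_div ler_pdivrMr// mulrC mulrA ler_pdivlMr ?mulr_gt0// mul1r.
rewrite mulrA divfK//; case: (leP r delta) => rd.
  by rewrite [delta * r]mulrC ler_wpM2l// ltW.
by rewrite ler_wpM2l// ltW.
Qed.

Lemma assouad_dim_bound (a : \bar R) (s : R) :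
  (assouad_dim X <= a)%E -> (a < s%:E)%E -> assouad_bound s.
Proof.
rewrite assouad_dimE => Xa; apply: ereal_inf_real_lt Xa => t u.
exact: assouad_bound_up.
Qed.

Lemma assouad_dim_le (a : \bar R) : (0 <= a)%E ->
  (forall s : R, 0 < s -> (a < s%:E)%E -> assouad_bound s) ->
  (assouad_dim X <= a)%E.
Proof. by move=> a0 aP; rewrite assouad_dimE; exact: ereal_inf_real_le. Qed.

(** The bound is used at the midpoint of [a] and [s]; the other half of the gap in the exponent
    absorbs [C] for small [r]. *)
Lemma upper_box_dim_le_of_powR (a : \bar R) : (0 <= a)%E ->
  (forall s : R, 0 < s -> (a < s%:E)%E -> exists C delta : R, 0 < delta /\
    forall r, 0 < r -> r < delta ->
      (covering_number [set: X] r <= (C * r `^ (- s))%:E)%E) ->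
  (upper_box_dim X <= a)%E.
Proof.
move=> a0 aP; apply/upper_box_dim_leP => // s s0 as0.
have [a1 a1E] : exists a1, a = a1%:E.
  by case: a a0 as0 {aP} => [a1||]//; exists a1.
rewrite {}a1E in a0 as0 aP; rewrite lee_fin in a0; rewrite lte_fin in as0.
have [||C [delta [delta0 XC]]] := aP ((a1 + s) / 2); first by lra.
  by rewrite lte_fin; lra.
have c0 : 0 < (s - a1) / 2 by lra.
have [r1 r10 r1P] := powRN_ge C c0.
exists (Num.min r1 delta); first by rewrite lt_min r10.
move=> r r0; rewrite lt_min => /andP[rr1 rd]; apply: (le_trans (XC r r0 rd)).
rewrite lee_fin (_ : - s = - ((s - a1) / 2) + - ((a1 + s) / 2)); last by lra.
rewrite powRD; last by rewrite (lt0r_neq0 r0) implybT.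
by rewrite ler_wpM2r ?powR_ge0// r1P.
Qed.

Lemma upper_box_dim_le_assouad (a : \bar R) : (0 <= a)%E ->
  (assouad_dim X <= a)%E -> (upper_box_dim X <= a)%E.
Proof.
move=> a0 Xa; apply: upper_box_dim_le_of_powR => // s s0 as0.
have /(assouad_bound_local ltr01 s0)[C _ [_ XC]] := assouad_dim_bound Xa as0.
by exists C, 1.
Qed.

End box_assouad.

Section decomposition_covering.
Context {R : realType} (W : compactMetricType R) (I : finType).
Context (Z : I -> compactMetricType R) (iota : forall i, Z i -> W) (delta : R).
Arguments iota : clear implicits.
Hypothesis dec : decomposition iota delta.

Lemma covers_image i (S : set (Z i)) r u :
  covers S r u -> covers (iota i @` S) r (map (iota i) u).
Proof.
move=> [uS cu]; split=> [_ /mapP[z /uS Sz ->]|_ [z /cu[x xu xz] <-]].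
  by exists z.
exists (iota i x); first exact: map_f.
exact: le_trans (decomposition_le dec _ _) xz.
Qed.

Lemma covers_flatten r (u : forall i, seq (Z i)) :
  (forall i, covers setT r (u i)) ->
  covers setT r (flatten [seq map (iota i) (u i) | i <- enum I]).
Proof.
move=> cu; split=> // w _; have [i [z <-]] := decomposition_cover dec w.
have [_ /(_ _ (imageT (iota i) z))[x xu xz]] := covers_image (cu i).
exists x => //; apply/flattenP; exists (map (iota i) (u i)) => //.
by apply: map_f; rewrite mem_enum.
Qed.

(** As [r < delta], only centers inside the piece cover points of the piece; the others are
    dropped. *)
Lemma covers_preimage i (S : set (Z i)) (S' : set W) r u :
  r < delta -> iota i @` S `<=` S' -> iota i @^-1` S' `<=` S ->
  covers S' r u -> exists2 u', covers S r u' & (size u' <= size u)%N.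
Proof.
move=> rd SS' S'S [uS cu].
have [z0 _] := @compact_metric_nonempty _ (Z i).
have /choice[g gP] w : exists z, range (iota i) w -> iota i z = w.
  by have [[z _ <-]|nw] := pselect (range (iota i) w); [exists z|exists z0].
exists [seq g w | w <- u & `[< range (iota i) w >]]; last first.
  by rewrite size_map size_filter count_size.
split=> [_ /mapP[w + ->]|z Sz].
  rewrite mem_filter => /andP[/asboolP iw wu].
  by apply: S'S; rewrite /= gP//; exact: uS.
have [w wu wz] : exists2 w, w \in u & mdist w (iota i z) <= r.
  by apply: cu; apply: SS'; exists z.
have [|x xw xz] := @decomposition_near _ _ _ _ _ _ dec i z w.
  by rewrite metric_sym (le_lt_trans wz).
have iw : range (iota i) w by exists x.
exists (g w); first by apply: map_f; rewrite mem_filter wu andbT; exact/asboolP.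
rewrite (_ : g w = x); last by apply: (decomposition_inj dec); rewrite gP.
by rewrite metric_sym xz metric_sym.
Qed.

Lemma covering_number_le_decomposition i r : r < delta ->
  (covering_number [set: Z i] r <= covering_number [set: W] r)%E.
Proof.
move=> rd; apply: le_ereal_inf_tmp => _ [k [A [AT Ak cA]] <-].
have /covering_numberP[u cu uk] : (covering_number [set: W] r <= k%:R%:E)%E.
  by apply: ereal_inf_lbound; exists k => //; exists A.
have [u' cu' uu'] := @covers_preimage i setT setT _ _ rd (@subsetT _ _) (@subsetT _ _) cu.
by apply/covering_numberP; exists u' => //; rewrite (le_trans _ uk)// ler_nat.
Qed.

Lemma decomposition_covering_number_le (t : I -> R) r :
  (forall i, (covering_number [set: Z i] r <= (t i)%:E)%E) ->
  (covering_number [set: W] r <= (\sum_i t i)%:E)%E.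
Proof.
move=> Zt.
have /dependent_functional_choice[u uP] i : exists u : seq (Z i),
    covers setT r u /\ (size u)%:R <= t i.
  by have /covering_numberP[u] := Zt i; exists u.
apply/covering_numberP; exists (flatten [seq map (iota i) (u i) | i <- enum I]).
  by apply: covers_flatten => i; case: (uP i).
rewrite size_flatten /shape -map_comp sumnE big_map big_enum/= natr_sum.
by apply: ler_sum => i _; rewrite size_map; case: (uP i).
Qed.

Lemma upper_box_dim_le_decomposition i :
  (upper_box_dim (Z i) <= upper_box_dim W)%E.
Proof.
apply/upper_box_dim_leP; first exact: upper_box_dim_ge0.
move=> s s0 Ws; have /upper_box_dim_leP := lexx (upper_box_dim W).
move=> /(_ (upper_box_dim_ge0 W) s s0 Ws)[r0 r00 r0P].
exists (Num.min r0 delta); first by rewrite lt_min r00 (decomposition_gt0 dec).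
move=> r r'0; rewrite lt_min => /andP[rr0 rd].
exact: le_trans (covering_number_le_decomposition i rd) (r0P r r'0 rr0).
Qed.

(** Covers of the pieces add up, which costs a constant factor [#|I|] that the upper box dimension
    ignores. *)
Lemma decomposition_upper_box_dim_le (a : \bar R) : (0 <= a)%E ->
  (forall i, (upper_box_dim (Z i) <= a)%E) -> (upper_box_dim W <= a)%E.
Proof.
move=> a0 Za; apply: upper_box_dim_le_of_powR => // s s0 as0.
have /choice[r0 r0P] i : exists r0 : R, 0 < r0 /\ forall r, 0 < r -> r < r0 ->
    (covering_number [set: Z i] r <= (r `^ (- s))%:E)%E.
  have /upper_box_dim_leP := Za i.
  by move=> /(_ a0 s s0 as0)[r0 r00 r0P]; exists r0.
exists #|I|%:R, (\big[Num.min/1]_i r0 i); split.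
  by apply: (big_ind (fun x => 0 < x)) => // [x y x0 y0|i _];
    [rewrite lt_min x0|case: (r0P i)].
move=> r r'0 rr0.
rewrite mulr_natl -sumr_const; apply: decomposition_covering_number_le => i.
have [_] := r0P i; apply => //; apply: lt_le_trans rr0 _.
exact: bigmin_le_cond.
Qed.

Lemma assouad_dim_le_decomposition i :
  (0 <= assouad_dim W)%E -> (assouad_dim (Z i) <= assouad_dim W)%E.
Proof.
move=> W0; apply: assouad_dim_le => // s s0 Ws.
have delta0 := decomposition_gt0 dec.
apply/(assouad_bound_local _ delta0 s0).
have /(assouad_bound_local _ delta0 s0)[C C0 [CP CW]] :=
  assouad_dim_bound (lexx _) Ws.
exists C => //; split=> [z r rho rrho rd|r r0 rd].
  have /covering_numberP[u cu ut] := CP (iota i z) r rho rrho rd.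
  have r'd : r < delta by have /andP[_ /lt_trans] := rrho; exact.
  rewrite (decomposition_cball dec)// in cu.
  have [//||u' cu' uu'] := @covers_preimage i (cball z rho) _ r u r'd _ _ cu.
    by move=> z' [x xz xz']; rewrite -(decomposition_inj dec xz').
  by apply/covering_numberP; exists u' => //; rewrite (le_trans _ ut)// ler_nat.
exact: le_trans (covering_number_le_decomposition i rd) (CW r r0 rd).
Qed.

(** By [assouad_bound_local] it suffices to treat balls of radius below [delta], which lie in one
    piece, and covers of the whole space, which add up. *)
Lemma decomposition_assouad_dim_le (a : \bar R) : (0 <= a)%E ->
  (forall i, (assouad_dim (Z i) <= a)%E) -> (assouad_dim W <= a)%E.
Proof.
move=> a0 Za; apply: assouad_dim_le => // s s0 as0.
have delta0 := decomposition_gt0 dec.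
have /choice[C CP] i : exists C : R, 0 < C /\
    ((forall (x : Z i) (r rho : R), 0 < r < rho -> rho < delta ->
      (covering_number (cball x rho) r <= (C * (rho / r) `^ s)%:E)%E) /\
    (forall r, 0 < r -> r < delta ->
      (covering_number [set: Z i] r <= (C * r `^ (- s))%:E)%E)).
  have /(assouad_bound_local _ delta0 s0)[C C0 CP] := assouad_dim_bound (Za i) as0.
  by exists C.
have CS i : C i <= \sum_j C j + 1.
  rewrite (bigD1 i)//= -addrA lerDl addr_ge0// sumr_ge0// => j _.
  by case: (CP j) => /ltW.
apply/(assouad_bound_local _ delta0 s0); exists (\sum_i C i + 1).
  by rewrite ltr_wpDl// sumr_ge0// => j _; case: (CP j) => /ltW.
split=> [w r rho rrho rd|r r0 rd].
  have [i [z <-]] := decomposition_cover dec w.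
  have [_ [+ _]] := CP i => /(_ z r rho rrho rd)/covering_numberP[u cu ut].
  apply/covering_numberP; exists (map (iota i) u).
    by rewrite (decomposition_cball dec)//; exact: covers_image.
  by rewrite size_map (le_trans ut)// ler_wpM2r ?powR_ge0.
apply: le_trans (@decomposition_covering_number_le (fun i => C i * r `^ (- s)) r _) _.
  by move=> i; have [_ [_]] := CP i; exact.
by rewrite -mulr_suml lee_fin ler_wpM2r ?powR_ge0// lerDl.
Qed.

End decomposition_covering.

(** * A sequence converging so fast that all dimensions vanish *)

Section countable_spaces.
Context {R : realType} (X : compactMetricType R) (e : nat -> X).
Hypothesis e_surj : forall x, exists k, e k = x.
Local Open Scope ereal_scope.

Lemma diam_set1 (x : X) : diam [set x] = 0.
Proof.
apply/eqP; rewrite eq_le diam_ge0 andbT; apply/diamP; split=> // _ _ -> ->.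
by rewrite mdistxx.
Qed.

Lemma countable_hausdorff_dim_le0 : hausdorff_dim X <= 0.
Proof.
apply: ereal_inf_real_le => // s s0 _; apply/hausdorff_measure0P => delta eta delta0 eta0.
exists (fun k => [set e k]); split.
- by move=> x _; have [k <-] := e_surj x; exists k.
- by move=> k; rewrite diam_set1.
- rewrite eseries0// => k _ _; rewrite diam_set1 poweR0r// gt_eqF//.
Qed.

(** Balls with the same center meet, so a packing has at most one ball; its radius is kept below the
    root of order [s] of [eta]. *)
Lemma packing_premeasure0_set1 (s : R) (x : X) : (0 < s)%R ->
  packing_premeasure0 s [set x] = 0.
Proof.
move=> s0; apply/eqP; rewrite eq_le packing_premeasure0_ge0 andbT.
apply/lee_addgt0Pr => eta eta0; rewrite add0e.
apply: ge_ereal_inf; exists (packing_premeasure s (eta `^ s^-1)%R [set x]).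
  by exists (eta `^ s^-1)%R => //; exact: powR_gt0.
apply: ge_ereal_sup => _ [I [c [r [cx rd tr ->]]]].
have sub1 i j : I i -> I j -> i = j.
  move=> Ii Ij; apply: tr => //; exists x; rewrite /cball /=.
  rewrite (cx i Ii) (cx j Ij) mdistxx.
  by have /andP[/ltW + _] := rd i Ii; have /andP[/ltW + _] := rd j Ij.
have [[i Ii]|I0] := pselect (exists i, I i); last first.
  rewrite (_ : I = set0); first by rewrite esum_set0 lee_fin ltW.
  by rewrite -subset0 => i Ii; apply: I0; exists i.
rewrite (_ : I = [set i]); last first.
  by apply/seteqP; split=> [j Ij|_ ->//]; exact: sub1.
rewrite esum_set1 ?lee_fin ?powR_ge0//.
have /andP[r0 rdi] := rd i Ii.
apply: (@le_trans _ _ ((eta `^ s^-1) `^ s)%R).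
  by apply: ge0_ler_powR; rewrite ?nnegrE ?powR_ge0// ltW.
by rewrite -powRrM mulVf ?lt0r_neq0// powRr1// ltW.
Qed.

Lemma countable_packing_dim_le0 : packing_dim X <= 0.
Proof.
apply: ereal_inf_real_le => // s s0 _; apply/packing_measure0P => eta eta0.
exists (fun k => [set e k]).
  by move=> x _; have [k <-] := e_surj x; exists k.
by rewrite eseries0// => k _ _; exact: packing_premeasure0_set1.
Qed.

End countable_spaces.

(* [Some k] is the k-th point of the sequence and [None] its limit. *)
Definition radius (R : realType) (t : nat -> R) (x : option nat) : R :=
  if x is Some k then t k else 0.

(** The k-th point is at distance [t k] from the limit and at least [t k] from all other points, so
    [t k] is visible in the metric as the scale up to which this point is isolated. *)
Definition sequence_dist (R : realType) (t : nat -> R) (x y : option nat) : R :=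
  if x == y then 0 else Num.max (radius t x) (radius t y).

Section sequence_space.
Context {R : realType} (t : nat -> R).
Hypothesis t_gt0 : forall k, 0 < t k.
Hypothesis t_decr : forall k, t k.+1 * 2 ^+ k.+1 <= t k.

Let rad_ge0 x : 0 <= radius t x.
Proof. by case: x => //= k; exact: ltW. Qed.

Lemma sequence_dist_ultra x y z : sequence_dist t x y <=
  Num.max (sequence_dist t x z) (sequence_dist t z y).
Proof.
rewrite /sequence_dist; have [->|xy] := eqVneq x y.
  by case: eqP => _; case: eqP => _; rewrite !le_max ?lexx ?rad_ge0.
have [<-|xz] := eqVneq x z; first by rewrite (negbTE xy) le_max lexx orbT.
have [<-|zy] := eqVneq z y; first by rewrite le_max lexx.
by rewrite ge_max !le_max !lexx ?orbT.
Qed.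

Lemma sequence_dist_metric : is_metric (sequence_dist t).
Proof.
have d0 x y : 0 <= sequence_dist t x y.
  by rewrite /sequence_dist; case: eqP => // _; rewrite le_max rad_ge0.
split=> //.
- move=> x y; split=> [|->]; last by rewrite /sequence_dist eqxx.
  rewrite /sequence_dist; case: eqP => // xy /eqP; rewrite eq_le => /andP[+ _].
  rewrite ge_max; case: x xy => [k|] xy /=; first by rewrite leNgt t_gt0.
  by case: y xy => [k|//] xy /=; rewrite [t k <= 0]leNgt t_gt0 andbF.
- by move=> x y; rewrite /sequence_dist eq_sym maxC.
- move=> x y z; apply: le_trans (sequence_dist_ultra x z y) _.
  by rewrite ge_max lerDl lerDr !d0.
Qed.

(** From index [J] on, consecutive radii have ratio at least [2 ^+ J], and [J] is free. A large [J]
    will make any given positive power of this ratio at least 2. *)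
Lemma sequence_geometric k p J : (J <= k)%N -> t (k + p) * (2 ^+ J) ^+ p <= t k.
Proof.
move=> Jk; elim: p => [|p IH]; first by rewrite addn0 expr0 mulr1.
apply: le_trans IH; rewrite exprS mulrA ler_wpM2r ?exprn_ge0//.
rewrite addnS; apply: le_trans (t_decr _); rewrite ler_wpM2l ?(ltW (t_gt0 _))//.
by rewrite ler_weXn2l ?ler1n// (leq_trans Jk)// (leq_trans (leq_addr p k)).
Qed.

Lemma sequence_le k l : (k <= l)%N -> t l <= t k.
Proof.
move=> kl; have := @sequence_geometric k (l - k) 0 (leq0n k).
by rewrite subnKC// expr0 expr1n mulr1.
Qed.

Lemma sequence_small (e : R) : 0 < e -> exists N, forall k, (N <= k)%N -> t k < e.
Proof.
(* From index 1 on the radii at least halve at each step, and [n < 2 ^ n]. *)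
move=> e0; pose N := Num.truncn (t 1%N / e).
exists (1 + N.+1)%N => k Nk; apply: le_lt_trans (sequence_le Nk) _.
have N2 : t 1%N / e < 2 ^+ N.+1.
  apply: lt_le_trans (truncnS_gt _) _.
  by rewrite -natrX ler_nat ltnW// ltn_expl.
have := @sequence_geometric 1 N.+1 1 (leqnn 1).
rewrite expr1 -ler_pdivlMr ?exprn_gt0// => /le_lt_trans; apply.
by rewrite ltr_pdivrMr ?exprn_gt0// mulrC -ltr_pdivrMr.
Qed.

Definition sequence_metric : metricType R := metric_space sequence_dist_metric.

Lemma sequence_ball k (y : sequence_metric) :
  mdist (Some k : sequence_metric) y < t k -> y = Some k.
Proof.
rewrite /mdist /= /sequence_dist; case: eqP => [<-//|_].
by rewrite gt_max ltxx.
Qed.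

(** A filter that does not cluster at the limit contains a set that avoids a ball around it, hence a
    finite set. *)
Lemma sequence_compact : compact [set: metric_space sequence_dist_metric].
Proof.
move=> F FF _; apply: contrapT => nF.
have [A [B [FA NB AB]]] : exists A B : set sequence_metric,
    [/\ F A, nbhs (None : sequence_metric) B & A `&` B = set0].
  apply: contrapT => n; apply: nF; exists None; split=> // A B FA NB.
  apply: contrapT => AB; apply: n; exists A, B; split=> //.
  by apply/eqP; rewrite -[_ == _]negbK; apply/negP => /set0P.
have [e e0 eB] := mdist_nbhs NB; have [N NP] := sequence_small e0.
pose C := (@Some nat : nat -> sequence_metric) @` `I_N.
have /finite_compact/(_ F FF)[|p [_ Fp]] : finite_set C.
- exact: finite_image.
- apply: filterS FA => -[k|] Ak.
    exists k => //=; rewrite ltnNge; apply/negP => /NP tk.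
    suff : (A `&` B) (Some k) by rewrite AB.
    split=> //; apply: eB; rewrite /= /mdist /= /sequence_dist /=.
    by rewrite max_r// ltW.
  suff : (A `&` B) None by rewrite AB.
  by split=> //; apply: eB; rewrite /= mdistxx.
- by apply: nF; exists p.
Qed.

Definition sequence_space : compactMetricType R :=
  compact_metric_space sequence_compact None.

Let Q := sequence_space.

Let mdistQ (x y : Q) : mdist x y = sequence_dist t x y. Proof. by []. Qed.

Lemma sequence_hausdorff_dim : (hausdorff_dim Q <= 0)%E.
Proof.
apply: (@countable_hausdorff_dim_le0 R Q (fun k => if k is k'.+1 then Some k' else None)).
by case=> [k|]; [exists k.+1|exists 0%N].
Qed.

Lemma sequence_packing_dim : (packing_dim Q <= 0)%E.
Proof.
apply: (@countable_packing_dim_le0 R Q (fun k => if k is k'.+1 then Some k' else None)).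
by case=> [k|]; [exists k.+1|exists 0%N].
Qed.

(** A ball around the limit inside one member of the cover and the finitely many other points as
    singletons form an open partition refining the cover. *)
Lemma sequence_topological_dim : (topological_dim R Q <= 0)%E.
Proof.
apply: ge_ereal_inf; exists 0%:R%:E => //; exists 0%N => // U fU oU cU.
have : (\bigcup_(A in U) A) (None : Q) by rewrite cU.
move=> [A UA A0]; have [e e0 eA] := open_mdist (oU _ UA) A0.
pose T : set Q := [set y | radius t y < e].
have singleton_open (k : nat) : open [set (Some k : Q)].
  apply: mdist_open => _ ->; exists (t k) => // y; exact: sequence_ball.
pose far : set Q := [set y | e <= radius t y].
exists ([set T] `|` (fun y => [set y]) @` far); split.
- rewrite finite_setU; split; first exact: finite_set1.
  apply: finite_image; have [N NP] := sequence_small e0.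
  apply: (@sub_finite_set _ _ ((@Some nat : nat -> Q) @` `I_N)).
    move=> [k|]; rewrite /far /=; last by rewrite leNgt e0.
    by move=> ek; exists k => //; rewrite ltnNge; apply/negP => /NP; rewrite ltNge ek.
  exact: finite_image.
- move=> _ [->|[[k|] yfar <-]]; last 2 first.
  + exact: singleton_open.
  + by move: yfar; rewrite /far /= leNgt e0.
  apply: mdist_open => -[k|] ke.
    by exists (t k) => // y /sequence_ball ->.
  exists e => // y; rewrite /= mdistQ /sequence_dist /T /=.
  by case: eqP => [<-//|_]; rewrite max_r.
- rewrite -subTset => y _; have [ye|ey] := ltP (radius t y) e.
    by exists T => //; left.
  by exists [set y] => //; right; exists y.
- move=> _ [->|[y _ <-]].
    exists A => // y ye; apply: eA; rewrite /= mdistQ /sequence_dist.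
    by case: eqP => // _; rewrite max_r.
  have : (\bigcup_(A in U) A) y by rewrite cU.
  by move=> [B UB By]; exists B => // _ ->.
- move=> y; have [ye|ey] := ltP (radius t y) e.
    apply: (@card_le_trans _ _ _ [set T]).
      apply: subset_card_le => _ [[->//|[z zfar <-]] yz].
      by move: zfar; rewrite /far /= -yz leNgt ye.
    by rewrite (card_le_eql card_set1).
  apply: (@card_le_trans _ _ _ [set [set y]]).
    apply: subset_card_le => _ [[->|[z zfar <-]] yz].
      by move: yz; rewrite /T /= ltNge ey.
    by rewrite yz.
  by rewrite (card_le_eql card_set1).
Qed.

(** Each of the [p] steps contributes a factor at least [2 ^+ J] to the quotient, hence at least 2
    to its power, and [p.+1 <= 2 ^ p]. *)
Lemma sequence_ratio (J p k : nat) (lambda : R) : 0 < lambda -> (J <= k)%N ->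
  2 <= (2 ^+ J) `^ lambda -> p.+1%:R <= (t k / t (k + p)) `^ lambda.
Proof.
move=> l0 Jk J2; apply: (@le_trans _ _ (2 ^+ p)).
  by rewrite -natrX ler_nat ltn_expl.
apply: (@le_trans _ _ (((2 ^+ J) `^ lambda) ^+ p)).
  by rewrite lerXn2r ?nnegrE ?powR_ge0.
rewrite -powR_mulrn ?powR_ge0// powRAC powR_mulrn ?exprn_ge0//.
apply: ge0_ler_powR; rewrite ?nnegrE ?exprn_ge0 ?divr_ge0 ?(ltW (t_gt0 _)) ?(ltW l0)//.
by rewrite ler_pdivlMr// mulrC sequence_geometric.
Qed.

(** If the last index is counted, then [r] is below the smallest radius of the range and
    [sequence_ratio] bounds the length of the whole range; otherwise the last index is dropped. *)
Lemma sequence_count (J k n : nat) (lambda r rho : R) : 0 < lambda ->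
  (J <= k)%N -> 2 <= (2 ^+ J) `^ lambda -> 0 < r -> r < rho -> t k <= rho ->
  (count (fun i => r < t i) (iota k n))%:R <= (rho / r) `^ lambda.
Proof.
move=> l0 Jk J2 r0 rrho tk; elim: n => [|n IH]; first by rewrite powR_ge0.
rewrite -addn1 iotaD count_cat /= addn0.
case: ltP => [rt|_]; last by rewrite addn0.
apply: (@le_trans _ _ n.+1%:R).
  by rewrite addn1 ler_nat ltnS (leq_trans (count_size _ _))// size_iota.
apply: le_trans (sequence_ratio n l0 Jk J2) _.
apply: ge0_ler_powR; rewrite ?nnegrE ?divr_ge0 ?(ltW (t_gt0 _)) ?(ltW l0) ?(ltW r0)//.
  by rewrite ltW// (lt_trans r0).
apply: ler_pM; rewrite ?invr_ge0 ?(ltW (t_gt0 _))//.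
by rewrite lef_pV2 ?posrE// ltW.
Qed.

Lemma sequence_assouad_dim : (assouad_dim Q <= 0)%E.
Proof.
apply: assouad_dim_le => // lambda l0 _; split=> //.
have [J J2] : exists J, 2 <= (2 ^+ J) `^ lambda :> R.
  pose J := (Num.truncn lambda^-1).+1; exists J.
  rewrite -powR_mulrn// -powRrM -[leLHS]powRr1//.
  apply: ler_powR; first by rewrite ler1n.
  by rewrite -ler_pdivrMr// mul1r ltW// truncnS_gt.
(* [J] for the first points of the sequence in the ball, 2 for [x] and the limit, and 1 for the
   remaining points, which [sequence_count] bounds. *)
exists (J.+3)%:R => // x r rho /andP[r0 rrho].
have rho0 : 0 < rho by exact: lt_trans rrho.
have y1 : 1 <= (rho / r) `^ lambda.
  apply: (@le_trans _ _ (1 `^ lambda)); first by rewrite powR1.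
  apply: ge0_ler_powR; rewrite ?nnegrE ?(ltW l0)//.
    by rewrite divr_ge0 ?ltW.
  by rewrite ler_pdivlMr// mul1r ltW.
(* If [rho] is below [radius t x], the ball is reduced to [x]. *)
apply/covering_numberP; have [rhox|xrho] := ltP rho (radius t x).
  exists [:: x].
    split=> [y|y xy]; first by rewrite inE => /eqP ->; rewrite /cball /= mdistxx ltW.
    exists x; rewrite ?mem_head// mdistQ /sequence_dist.
    move: xy; rewrite /cball /= mdistQ /sequence_dist.
    by case: eqP => [_ _|_]; rewrite ?(ltW r0)// ge_max leNgt rhox.
  by rewrite (le_trans y1)// ler_peMl ?powR_ge0// ler1n.
have exk : exists k, t k <= rho.
  by have [N NP] := sequence_small rho0; exists N; exact/ltW/NP.
pose k1 := ex_minn exk.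
have k1P : t k1 <= rho by rewrite /k1; case: ex_minnP.
have k1min k : t k <= rho -> (k1 <= k)%N by rewrite /k1; case: ex_minnP => m _; exact.
(* Points of radius at most [r] are covered by the limit; all others have an index below [N], so the
   list of centers can be finite. *)
have [N NP] := sequence_small r0.
exists (x :: None :: [seq Some k | k <- iota k1 J] ++
    [seq Some k | k <- iota (k1 + J) N & r < t k]).
  have inball (y : Q) : radius t y <= rho -> cball x rho y.
    move=> yrho; rewrite /cball /= mdistQ /sequence_dist; case: eqP => // _.
      exact: ltW.
    by rewrite ge_max xrho.
  split=> [y|y xy].
    rewrite inE => /predU1P[->|]; first by rewrite /cball /= mdistxx ltW.
    rewrite inE => /predU1P[->|]; first by apply: inball; exact: ltW.
    rewrite mem_cat => /orP[|] /mapP[k + ->]; rewrite ?mem_filter mem_iota.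
      by move=> /andP[k1k _]; apply: inball; exact: le_trans (sequence_le k1k) _.
    move=> /and3P[_ k1k _]; apply: inball; apply: le_trans (sequence_le _) k1P.
    exact: leq_trans (leq_addr _ _) k1k.
  have [xy'|xy'] := eqVneq (x : option nat) y.
    by exists x; rewrite ?mem_head// xy' mdistxx ltW.
  have yrho : radius t y <= rho.
    move: xy; rewrite /cball /= mdistQ /sequence_dist (negbTE xy').
    by rewrite ge_max => /andP[].
  have [yr|ry] := leP (radius t y) r.
    exists None; first by rewrite !inE eqxx orbT.
    rewrite mdistQ /sequence_dist; case: eqP => // _; first exact: ltW.
    by rewrite ge_max yr ltW.
  exists y; last by rewrite mdistxx ltW.
  case: y xy xy' yrho ry => [k|] xy xy' /= yrho ry; last first.
    by rewrite ltNge (ltW r0) in ry.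
  rewrite !inE mem_cat; apply/orP; right; apply/orP; right.
  have k1k := k1min k yrho.
  have [kJ|Jk] := ltnP k (k1 + J).
    by apply/orP; left; apply: map_f; rewrite mem_iota k1k.
  apply/orP; right; apply: map_f; rewrite mem_filter ry mem_iota Jk/=.
  rewrite (@leq_trans N)// ?leq_addl// ltnNge; apply/negP => /NP.
  by rewrite ltNge (ltW ry).
rewrite /= size_cat !size_map size_iota size_filter.
have c : (count (fun k => r < t k) (iota (k1 + J) N))%:R <= (rho / r) `^ lambda.
  apply: (@sequence_count J); rewrite ?leq_addl//.
  by apply: le_trans k1P; exact: sequence_le (leq_addr _ _).
have J0 : 0 <= J%:R :> R by [].
rewrite -addn2 2!natrD -[J.+3]addn3 natrD.
have h : J%:R + 2 <= (J%:R + 2) * (rho / r) `^ lambda by rewrite ler_peMr ?addr_ge0.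
by move: c h; set c' := (count _ _)%:R; set y := _ `^ _; lra.
Qed.

Lemma sequence_upper_box_dim : (upper_box_dim Q <= 0)%E.
Proof. by apply: upper_box_dim_le_assouad => //; exact: sequence_assouad_dim. Qed.

End sequence_space.

(** * Gluing truncated pieces *)

(* Pitfall: ['I_n] has type [predArgType], which makes [{i : 'I_n & X i}] too
   large to be the carrier of a compact metric space. *)
Definition idx (n : nat) : Set := {m : nat | (m < n)%N}.

Section idx_finite.
Variable n : nat.

Definition ord_of_idx (i : idx n) : 'I_n := Ordinal (svalP i).
Definition idx_of_ord (i : 'I_n) : idx n := exist _ (val i) (ltn_ord i).

Lemma ord_of_idxK : cancel ord_of_idx idx_of_ord.
Proof.
move=> [m mn]; rewrite /idx_of_ord /ord_of_idx /=; congr exist.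
exact: bool_irrelevance.
Qed.

Lemma idx_of_ordK : cancel idx_of_ord ord_of_idx.
Proof. by move=> i; exact: val_inj. Qed.

HB.instance Definition _ := Finite.copy (idx n) (can_type ord_of_idxK).
End idx_finite.

Section wedge_of_pieces.
Context {R : realType} {W : Type} {J : eqType} (tg : W -> J).
Variables (d : W -> W -> R) (b : W -> R) (eps : R).
Hypothesis b0 : forall w, 0 <= b w.
Hypotheses (d0 : forall w w', 0 <= d w w') (dxx : forall w, d w w = 0).
Hypothesis d_sym : forall w w', tg w = tg w' -> d w w' = d w' w.

(* [b w] plays the role of the distance from [w] to the base point of its
   piece. *)
Definition wedge_dist (w w' : W) : R :=
  if tg w == tg w' then d w w' else Num.max (Num.max (b w) (b w')) eps.

Lemma wedge_dist_ge0 w w' : 0 <= wedge_dist w w'.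
Proof. by rewrite /wedge_dist; case: eqP => // _; rewrite !le_max b0. Qed.

Lemma wedge_distxx w : wedge_dist w w = 0.
Proof. by rewrite /wedge_dist eqxx. Qed.

Lemma wedge_dist_sym w w' : wedge_dist w w' = wedge_dist w' w.
Proof.
rewrite /wedge_dist eq_sym; case: eqP => [ww'|_]; first exact: d_sym.
by rewrite [Num.max (b w) _]maxC.
Qed.

(** The last two conditions are triangle inequalities with the base point. A step inside a piece
    changes [b] by at most its length, and a detour through another piece costs at least
    [b x + b z], which bounds [d x z]. *)
Lemma wedge_dist_triangle :
  (forall x y z, tg x = tg y -> tg y = tg z -> d x z <= d x y + d y z) ->
  (forall x y, tg x = tg y -> b x <= d x y + b y) ->
  (forall x y, tg x = tg y -> d x y <= b x + b y) ->
  forall x y z, wedge_dist x z <= wedge_dist x y + wedge_dist y z.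
Proof.
move=> dt bd db x y z; rewrite /wedge_dist.
have [xy|xy] := eqVneq (tg x) (tg y).
  rewrite -xy; have [xz|xz] := eqVneq (tg x) (tg z).
    by apply: dt => //; rewrite -xy.
  have h1 := bd _ _ xy; have h2 := d0 x y; rewrite -lerBlDl.
  have : b y <= Num.max (Num.max (b y) (b z)) eps by rewrite !le_max lexx.
  have : b z <= Num.max (Num.max (b y) (b z)) eps by rewrite !le_max lexx orbT.
  have : eps <= Num.max (Num.max (b y) (b z)) eps by rewrite !le_max lexx !orbT.
  move: (Num.max _ eps) => m e1 e2 e3.
  by rewrite lerBlDl !ge_max; apply/andP; split; [apply/andP; split|]; lra.
have [yz|yz] := eqVneq (tg y) (tg z).
  rewrite -yz (negbTE xy).
  have h1 := bd _ _ (esym yz); have h2 := d0 y z; rewrite (d_sym (esym yz)) in h1.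
  have : b y <= Num.max (Num.max (b x) (b y)) eps by rewrite !le_max lexx orbT.
  have : b x <= Num.max (Num.max (b x) (b y)) eps by rewrite !le_max lexx.
  have : eps <= Num.max (Num.max (b x) (b y)) eps by rewrite !le_max lexx !orbT.
  move: (Num.max (Num.max (b x) (b y)) eps) => m e1 e2 e3.
  by rewrite !ge_max; apply/andP; split; [apply/andP; split|]; lra.
have : b x <= Num.max (Num.max (b x) (b y)) eps by rewrite !le_max lexx.
have : eps <= Num.max (Num.max (b x) (b y)) eps by rewrite !le_max lexx !orbT.
have : b z <= Num.max (Num.max (b y) (b z)) eps by rewrite !le_max lexx orbT.
have : eps <= Num.max (Num.max (b y) (b z)) eps by rewrite !le_max lexx !orbT.
move: (Num.max (Num.max (b x) (b y)) eps) (Num.max (Num.max (b y) (b z)) eps).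
move=> m m' e1 e2 e3 e4; have bx := b0 x; have bz := b0 z.
have [xz|xz] := eqVneq (tg x) (tg z); first by have := db _ _ xz; lra.
by rewrite !ge_max; apply/andP; split; [apply/andP; split|]; lra.
Qed.

Lemma wedge_dist_ultra :
  (forall x y z, tg x = tg y -> tg y = tg z ->
    d x z <= Num.max (d x y) (d y z)) ->
  (forall x y, tg x = tg y -> b x <= Num.max (d x y) (b y)) ->
  (forall x y, tg x = tg y -> d x y <= Num.max (b x) (b y)) ->
  forall x y z, wedge_dist x z <= Num.max (wedge_dist x y) (wedge_dist y z).
Proof.
move=> dt bd db x y z; rewrite /wedge_dist.
have [xy|xy] := eqVneq (tg x) (tg y).
  rewrite -xy; have [xz|xz] := eqVneq (tg x) (tg z).
    by apply: dt => //; rewrite -xy.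
  rewrite !ge_max (le_trans (bd _ _ xy)) ?ge_max !le_max !lexx ?orbT//.
have [yz|yz] := eqVneq (tg y) (tg z).
  rewrite -yz (negbTE xy) !ge_max [b z <= _](le_trans (bd _ _ (esym yz))).
    by rewrite !le_max !lexx ?orbT.
  by rewrite ge_max (d_sym (esym yz)) !le_max !lexx ?orbT.
have [xz|xz] := eqVneq (tg x) (tg z).
  rewrite (le_trans (db _ _ xz))// ge_max !le_max !lexx ?orbT//.
by rewrite !ge_max !le_max !lexx ?orbT.
Qed.

End wedge_of_pieces.

Section min_lemmas.
Context {R : realDomainType}.
Implicit Types a b c : R.

Lemma ler_min_add a b b' c : 0 <= b -> 0 <= b' -> 0 <= c -> a <= b + b' ->
  Num.min a c <= Num.min b c + Num.min b' c.
Proof.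
move=> b0 b'0 c0 abb'; rewrite ge_min; apply/orP.
have [bc|/ltW bc] := leP b c; have [b'c|/ltW b'c] := leP b' c.
- by left.
- by right; rewrite lerDr.
- by right; rewrite lerDl.
- by right; rewrite lerDr.
Qed.

Lemma ler_min_max a b b' c : a <= Num.max b b' ->
  Num.min a c <= Num.max (Num.min b c) (Num.min b' c).
Proof.
rewrite le_max => /orP[ab|ab]; rewrite le_max; apply/orP; [left|right];
  by rewrite le_min !ge_min ab lexx ?orbT.
Qed.

Lemma ler_dist_min a a' c c' m : `|a - a'| <= m -> `|c - c'| <= m ->
  `|Num.min a c - Num.min a' c'| <= m.
Proof.
have half x x' y y' : x <= x' + m -> y <= y' + m ->
    Num.min x y <= Num.min x' y' + m.
  by move=> xm ym; have [_|_] := leP x' y'; rewrite ge_min ?xm ?ym ?orbT.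
rewrite !ler_norml => /andP[h1 h2] /andP[h3 h4].
have : Num.min a c <= Num.min a' c' + m by apply: half; lra.
have : Num.min a' c' <= Num.min a c + m by apply: half; lra.
by move=> h5 h6; apply/andP; split; lra.
Qed.

Lemma ler_dist_max a a' c c' m : `|a - a'| <= m -> `|c - c'| <= m ->
  `|Num.max a c - Num.max a' c'| <= m.
Proof.
move=> aa cc; rewrite -[a]opprK -[c]opprK -[a']opprK -[c']opprK -!oppr_min.
rewrite -opprD normrN; apply: ler_dist_min.
  by rewrite -opprD normrN.
by rewrite -opprD normrN.
Qed.

End min_lemmas.

Section glued_space.
Context {R : realType} (n : nat) (X : idx n -> compactMetricType R).
Variable p : forall i, X i.

(** Independent of the parameters, so that the distances for different points of [H] are functions
    on one set and can be subtracted. *)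
Definition glued_carrier : Type := ({i : idx n & X i} + option nat)%type.

Definition in_space i (x : X i) : glued_carrier := inl (existT _ i x).
Definition in_sequence (x : option nat) : glued_carrier := inr x.

Definition piece (w : glued_carrier) : option (idx n) :=
  match w with inl a => Some (tag a) | inr _ => None end.

(** Meaningful inside one piece; across pieces the value is junk, which [wedge_dist] does not
    read. *)
Definition piece_dist (t : nat -> R) (w w' : glued_carrier) : R :=
  match w, w' with
  | inl a, inl a' => mdist (tagged a) (tagged_as a a')
  | inr x, inr y => sequence_dist t x y
  | _, _ => 0
  end.

Definition piece_radius (t : nat -> R) (w : glued_carrier) : R :=
  match w with
  | inl a => mdist (tagged a) (p (tag a))
  | inr x => radius t x
  end.

(* A piece whose height [c i] is 0 collapses to its base point. *)
Definition glued_dist (t : nat -> R) (c : option (idx n) -> R) (eps : R) :=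
  wedge_dist piece (fun w w' => Num.min (piece_dist t w w') (c (piece w)))
    (fun w => Num.min (piece_radius t w) (c (piece w))) eps.

Lemma same_piece_ind (P : glued_carrier -> glued_carrier -> Prop) :
  (forall i (x y : X i), P (in_space x) (in_space y)) ->
  (forall x y : option nat, P (in_sequence x) (in_sequence y)) ->
  forall w w', piece w = piece w' -> P w w'.
Proof.
move=> Pl Pr [[i x]|x] [[j y]|y] //= [ij].
by subst j; exact: Pl.
Qed.

Lemma piece_dist_space t i (x y : X i) :
  piece_dist t (in_space x) (in_space y) = mdist x y.
Proof. by rewrite /piece_dist /= tagged_asE. Qed.

Lemma piece_dist_sym t w w' : piece w = piece w' ->
  piece_dist t w w' = piece_dist t w' w.
Proof.
move: w w'; apply: same_piece_ind => [i x y|x y].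
  by rewrite !piece_dist_space metric_sym.
by rewrite /= /sequence_dist eq_sym maxC.
Qed.

Lemma piece_distxx t w : piece_dist t w w = 0.
Proof.
by case: w => [[i x]|x]; rewrite ?piece_dist_space ?mdistxx//= /sequence_dist eqxx.
Qed.

Section fixed_parameters.
Variables (t : nat -> R) (c : option (idx n) -> R) (eps : R).
Hypothesis t_gt0 : forall k, 0 < t k.
Hypothesis t_decr : forall k, t k.+1 * 2 ^+ k.+1 <= t k.
Hypothesis c_ge0 : forall i, 0 <= c i.

Let D := glued_dist t c eps.

Let seqm : is_metric (sequence_dist t) := sequence_dist_metric t_gt0.

(** The limit is the base point of the sequence, which turns the conditions on radii into triangle
    inequalities. *)
Let seqNone x : sequence_dist t x None = radius t x.
Proof. by case: x => [k|]//; rewrite /sequence_dist/= max_l// ltW. Qed.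

Let radius_ge0 x : 0 <= radius t x.
Proof. by case: x => //= k; exact: ltW. Qed.

Let piece_radius_ge0 w : 0 <= piece_radius t w.
Proof. by case: w => [[i x]|x] //=; exact: mdist_ge0. Qed.

Let piece_dist_ge0 w w' : 0 <= piece_dist t w w'.
Proof.
case: w => [[i x]|x]; case: w' => [[j y]|y] //=; first exact: mdist_ge0.
by case: seqm.
Qed.

Let trunc_dist_ge0 w w' : 0 <= Num.min (piece_dist t w w') (c (piece w)).
Proof. by rewrite le_min piece_dist_ge0 c_ge0. Qed.

Let trunc_radius_ge0 w : 0 <= Num.min (piece_radius t w) (c (piece w)).
Proof. by rewrite le_min piece_radius_ge0 c_ge0. Qed.

Let trunc_dist_sym w w' : piece w = piece w' ->
  Num.min (piece_dist t w w') (c (piece w)) =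
  Num.min (piece_dist t w' w) (c (piece w')).
Proof. by move=> ww'; rewrite (piece_dist_sym _ ww') ww'. Qed.

Lemma glued_dist_ge0 w w' : 0 <= D w w'.
Proof. exact: wedge_dist_ge0. Qed.

Lemma glued_distxx w : D w w = 0.
Proof. by apply: wedge_distxx => w'; rewrite piece_distxx min_l. Qed.

Lemma glued_dist_sym w w' : D w w' = D w' w.
Proof. exact: wedge_dist_sym. Qed.

Lemma glued_dist_triangle w w' w'' : D w w'' <= D w w' + D w' w''.
Proof.
apply: wedge_dist_triangle => // [x y z xy yz|x y xy|x y xy].
- rewrite -xy; apply: ler_min_add => //.
  case: x y z xy yz => [[i x]|x] [[j y]|y] [[k z]|z] //=.
    move=> [ij] [jk]; subst j; subst k.
    rewrite !(@tagged_asE _ X (existT _ i x)) !(@tagged_asE _ X (existT _ i y)).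
    exact: metric_triangle.
  by case: seqm.
- rewrite -xy; apply: ler_min_add => //.
  move: x y xy; apply: same_piece_ind => [i x y|x y].
    by rewrite piece_dist_space; exact: metric_triangle.
  by rewrite /= -!seqNone; case: seqm.
- rewrite -xy; apply: ler_min_add => //.
  move: x y xy; apply: same_piece_ind => [i x y|x y].
    by rewrite piece_dist_space /= (metric_sym y); exact: metric_triangle.
  by rewrite /= -!seqNone; case: seqm => _ _ s; rewrite (s y).
Qed.

Lemma glued_dist_ultra : (forall i, is_ultrametric (X i)) ->
  forall x y z, D x y <= Num.max (D x z) (D z y).
Proof.
move=> Xu w w' w''; apply: wedge_dist_ultra => // [x y z xy yz|x y xy|x y xy].
- rewrite -xy; apply: ler_min_max.
  case: x y z xy yz => [[i x]|x] [[j y]|y] [[k z]|z] //=.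
    move=> [ij] [jk]; subst j; subst k.
    rewrite !(@tagged_asE _ X (existT _ i x)) !(@tagged_asE _ X (existT _ i y)).
    exact: Xu.
  by move=> _ _; exact: sequence_dist_ultra.
- rewrite -xy; apply: ler_min_max.
  move: x y xy; apply: same_piece_ind => [i x y|x y].
    by rewrite piece_dist_space; exact: Xu.
  by rewrite /= -!seqNone; exact: sequence_dist_ultra.
- rewrite -xy; apply: ler_min_max.
  move: x y xy; apply: same_piece_ind => [i x y|x y].
    by rewrite piece_dist_space /= (metric_sym y); exact: Xu.
  rewrite /= -!seqNone; case: seqm => _ _ s _; rewrite (s y).
  exact: sequence_dist_ultra.
Qed.

Section positive_parameters.
Hypotheses (eps_gt0 : 0 < eps) (eps_c : forall i, eps <= c i).

Lemma glued_dist_near w w' : D w w' < eps -> piece w = piece w'.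
Proof.
rewrite /D /glued_dist /wedge_dist; case: eqP => // _.
by rewrite gt_max ltxx andbF.
Qed.

Lemma glued_dist_nearE w w' : D w w' < eps -> D w w' = piece_dist t w w'.
Proof.
move=> /[dup] /glued_dist_near ww'.
rewrite /D /glued_dist /wedge_dist ww' eqxx.
by rewrite gt_min [c _ < _]ltNge eps_c orbF => dw; rewrite min_l// ltW// (lt_le_trans dw).
Qed.

Lemma glued_dist_metric : is_metric D.
Proof.
split.
- exact: glued_dist_ge0.
- move=> w w'; split=> [Dww'|->]; last exact: glued_distxx.
  have ww : D w w' < eps by rewrite Dww'.
  have := glued_dist_near ww; move: Dww'; rewrite (glued_dist_nearE ww) => + pp.
  move: w w' pp {ww}; apply: same_piece_ind => [i x y|x y].
    by rewrite piece_dist_space => /mdist_positivity ->.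
  by case: seqm => _ s _ _ /s ->.
- exact: glued_dist_sym.
- exact: glued_dist_triangle.
Qed.

Let M := metric_space glued_dist_metric.

Definition glued_piece (i : option (idx n)) : compactMetricType R :=
  if i is Some j then X j else sequence_space t_gt0 t_decr.

Definition glued_in (i : option (idx n)) : glued_piece i -> M :=
  match i with
  | Some j => fun x => in_space x
  | None => fun x => in_sequence x
  end.

Lemma piece_glued_in i z : piece (@glued_in i z) = i.
Proof. by case: i z. Qed.

Lemma piece_dist_glued_in i z z' :
  piece_dist t (@glued_in i z) (@glued_in i z') = mdist z z'.
Proof. by case: i z z' => [i|] z z' //=; rewrite tagged_asE. Qed.

Lemma glued_dist_le i z z' : D (@glued_in i z) (@glued_in i z') <= mdist z z'.
Proof.
rewrite /D /glued_dist /wedge_dist !piece_glued_in eqxx piece_dist_glued_in.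
by rewrite ge_min lexx.
Qed.

Lemma glued_in_cover (w : M) : exists i z, @glued_in i z = w.
Proof. by case: w => [[i x]|x]; [exists (Some i), x|exists None, x]. Qed.

Lemma glued_compact : compact [set: M].
Proof.
have -> : [set: M] = \big[setU/set0]_(i : option (idx n)) range (@glued_in i).
  apply/seteqP; split=> // w _; have [i [z <-]] := glued_in_cover w.
  by rewrite (bigD1 i)//=; left; exists z.
apply: bigsetU_compact => i _; apply: continuous_compact.
  apply: continuous_subspaceT => z A /mdist_nbhs[e e0 eA].
  apply: filterS (nbhs_mdist z e0) => z' zz'; apply: eA => /=.
  exact: le_lt_trans (glued_dist_le z z') zz'.
exact: compact_metric_compact.
Qed.

Definition glued_space : compactMetricType R :=
  compact_metric_space glued_compact (in_sequence None).

Lemma glued_decomposition :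
  @decomposition R glued_space _ glued_piece glued_in eps.
Proof.
split.
- exact: eps_gt0.
- exact: glued_in_cover.
- exact: glued_dist_le.
- by move=> i z z' /glued_dist_nearE h; rewrite -piece_dist_glued_in -h.
- by move=> i j z z' /glued_dist_near; rewrite !piece_glued_in.
Qed.

End positive_parameters.
End fixed_parameters.

(** The parameters enter only through [min] and [max], which are 1-Lipschitz for the maximum
    norm. *)
Lemma glued_dist_lipschitz t t' c c' eps eps' (m : R) :
  (forall k, `|t k - t' k| <= m) -> (forall i, `|c i - c' i| <= m) ->
  `|eps - eps'| <= m ->
  forall w w', `|glued_dist t c eps w w' - glued_dist t' c' eps' w w'| <= m.
Proof.
move=> tt' cc' ee' w w'; have m0 : 0 <= m by apply: le_trans ee'.
have rr' x : `|radius t x - radius t' x| <= m.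
  by case: x => [k|] //=; rewrite subrr normr0.
have bb' v : `|piece_radius t v - piece_radius t' v| <= m.
  by case: v => [[i x]|x] //=; rewrite subrr normr0.
rewrite /glued_dist /wedge_dist; case: eqP => [pp|_].
  apply: ler_dist_min => //; move: w w' pp; apply: same_piece_ind => [i x y|x y].
    by rewrite !piece_dist_space subrr normr0.
  rewrite /= /sequence_dist; case: eqP => _; first by rewrite subrr normr0.
  exact: ler_dist_max.
by apply: ler_dist_max => //; apply: ler_dist_max; exact: ler_dist_min.
Qed.

Section degenerate_parameters.
Variables (t : nat -> R) (c : option (idx n) -> R) (i : idx n).
Hypothesis t_gt0 : forall k, 0 < t k.
Hypothesis (c0 : forall j, j != Some i -> c j = 0).
Hypothesis (ci : forall x y : X i, mdist x y <= c (Some i)).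

Lemma glued_dist_degenerate (x y : X i) :
  glued_dist t c 0 (in_space x) (in_space y) = mdist x y.
Proof.
by rewrite /glued_dist /wedge_dist eqxx piece_dist_space min_l// ci.
Qed.

Lemma glued_dist_collapse (w : glued_carrier) :
  exists x : X i, glued_dist t c 0 (in_space x) w = 0.
Proof.
have [wi|wi] := eqVneq (piece w) (Some i).
  case: w wi => [[j y]|y] //= [ji]; subst j; exists y.
  by rewrite glued_dist_degenerate mdistxx.
(* All three terms of the maximum vanish: the base point has radius 0, the piece of [w] has height
   0, and the gap is 0. *)
exists (p i); rewrite /glued_dist /wedge_dist eq_sym (negbTE wi) /=.
rewrite mdistxx (min_l (le_trans (mdist_ge0 (p i) (p i)) (ci _ _))).
rewrite c0// (min_r (_ : 0 <= _)) ?maxxx//.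
by case: w {wi} => [[j y]|[k|]] //=; rewrite ?mdist_ge0// ltW.
Qed.

End degenerate_parameters.
End glued_space.

(** * Isolated points *)

Definition isolated (R : realType) (X : metricType R) (r : R) : set X :=
  [set x | forall y, y <> x -> r < mdist x y].

Section isolated_points.
Context {R : realType}.
Implicit Types X Y : compactMetricType R.

Lemma isolated_finite X (r : R) : 0 < r -> finite_set (@isolated R X r).
Proof.
move=> r0; have [N NP] := separated_bound (@compact_metric_compact R X) r0.
apply: contrapT => /(@infinite_set_fset _ _ N.+1)[B BX].
rewrite ltnNge NP// ?fset_uniq// => x y xB yB xy.
by apply/ltW/(BX x xB) => yx; rewrite yx eqxx in xy.
Qed.

Lemma finite_inj_surj (T : choiceType) (A : set T) (k : T -> T) :
  finite_set A -> (forall x, A x -> A (k x)) ->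
  (forall x y, A x -> A y -> k x = k y -> x = y) ->
  forall y, A y -> exists2 x, A x & k x = y.
Proof.
move=> Afin Ak kinj y Ay.
have memA x : (x \in fset_set A) = (x \in A) by rewrite in_fset_set.
have sub : ([fset k x | x in fset_set A] `<=` fset_set A)%fset.
  apply/fsubsetP => _ /imfsetP[x /= xA ->].
  by move: xA; rewrite !memA => /set_mem/Ak/mem_set.
have /eqP : [fset k x | x in fset_set A]%fset == fset_set A.
  rewrite eqEfcard sub /= card_in_imfset//= => x x'.
  by rewrite !memA => /set_mem Ax /set_mem Ax'; exact: kinj.
move=> /fsetP/(_ y); rewrite memA (mem_set Ay) => /imfsetP[x /= + ->].
by rewrite memA => /set_mem; exists x.
Qed.

Lemma isolated_isometry X Y (f : X -> Y) r x : is_isometric_embedding f ->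
  (forall y, exists x, f x = y) -> isolated r x -> isolated r (f x).
Proof.
move=> fi fsurj xr y; have [x' <-] := fsurj y => x'x.
by rewrite fi; apply: xr => xx'; apply: x'x; rewrite xx'.
Qed.

(* Composed with [g], an isometry would be an injection of the finite set of
   isolated points into itself, and not onto. *)
Lemma isolated_not_isometric X Y r (g : X -> Y) (y : Y) : 0 < r ->
  injective g -> (forall x, isolated r x -> isolated r (g x)) ->
  isolated r y -> (forall x, isolated r x -> g x <> y) -> ~ isometric X Y.
Proof.
move=> r0 ginj giso yr gy [f fi [f' fK f'K]].
have f'i : is_isometric_embedding f' by move=> a b; rewrite -fi !f'K.
have f'r z : isolated r z -> isolated r (f' z).
  by apply: isolated_isometry => // x; exists (f x).
have [||||x xr xy] := @finite_inj_surj X (@isolated R X r) (f' \o g) _ _ _ (f' y).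
- exact: isolated_finite.
- by move=> x /giso/f'r.
- by move=> x x' _ _ /= /(congr1 f); rewrite !f'K => /ginj.
- exact: f'r.
by apply: (gy x xr); rewrite -[LHS]f'K -[RHS]f'K; congr f.
Qed.

Lemma isolated_decomposition (W : compactMetricType R) (I : finType)
    (Z : I -> compactMetricType R) (iota : forall i, Z i -> W) (delta r : R) :
  decomposition iota delta -> r < delta ->
  forall i z, isolated r (iota i z) <-> isolated r z.
Proof.
move=> dec rd i z; split=> [zr z' z'z|zr w wz].
  apply: lt_le_trans (decomposition_le dec z z'); apply: zr.
  by move=> /(decomposition_inj dec).
rewrite ltNge; apply/negP => wr.
have [z' z'w zz'] := decomposition_near dec (le_lt_trans wr rd).
have /zr : z' <> z by move=> z'z; apply: wz; rewrite -z'w z'z.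
by rewrite zz' ltNge wr.
Qed.

Lemma isolated_sequence (t : nat -> R) (t_gt0 : forall k, 0 < t k)
    (t_decr : forall k, t k.+1 * 2 ^+ k.+1 <= t k) (r : R)
    (x : sequence_space t_gt0 t_decr) :
  0 < r -> isolated r x <-> exists2 k, x = Some k & r < t k.
Proof.
move=> r0.
have dE (a b : sequence_space t_gt0 t_decr) : mdist a b = sequence_dist t a b.
  by [].
split=> [xr|[k -> rk] y yk].
  case: x xr => [k|] xr.
    exists k => //; have := xr None ltac:(by []); rewrite dE /sequence_dist /=.
    by rewrite max_l// ltW.
  have [N /(_ N (leqnn N)) NP] := sequence_small t_gt0 t_decr r0.
  have := xr (Some N) ltac:(by []); rewrite dE /sequence_dist /= max_r ?ltW//.
  by rewrite ltNge ltW.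
rewrite dE /sequence_dist; case: eqP => [ky|_]; first by case: yk.
by rewrite lt_max rk.
Qed.

End isolated_points.

Section glued_spaces_distinct.
Context {R : realType} (n : nat) (X : idx n -> compactMetricType R).
Variable p : forall i, X i.
Variables (t t' : nat -> R) (c c' : option (idx n) -> R) (eps eps' : R).
Hypothesis t_gt0 : forall k, 0 < t k.
Hypothesis t_decr : forall k, t k.+1 * 2 ^+ k.+1 <= t k.
Hypothesis c_ge0 : forall i, 0 <= c i.
Hypotheses (eps_gt0 : 0 < eps) (eps_c : forall i, eps <= c i).
Hypothesis t'_gt0 : forall k, 0 < t' k.
Hypothesis t'_decr : forall k, t' k.+1 * 2 ^+ k.+1 <= t' k.
Hypothesis c'_ge0 : forall i, 0 <= c' i.
Hypotheses (eps'_gt0 : 0 < eps') (eps'_c : forall i, eps' <= c' i).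

Let W := glued_space p t_gt0 t_decr c_ge0 eps_gt0 eps_c.
Let W' := glued_space p t'_gt0 t'_decr c'_ge0 eps'_gt0 eps'_c.
Let dec := glued_decomposition p t_gt0 t_decr c_ge0 eps_gt0 eps_c.
Let dec' := glued_decomposition p t'_gt0 t'_decr c'_ge0 eps'_gt0 eps'_c.

(** At a scale below both [eps] and [t 0], the glued space has all the isolated points of [X i] and
    the first point of the sequence besides. *)
Lemma glued_space_not_piece i : ~ isometric (X i) W.
Proof.
pose r := Num.min eps (t 0%N) / 2.
have m0 : 0 < Num.min eps (t 0%N) by rewrite lt_min eps_gt0 t_gt0.
have r0 : 0 < r by rewrite divr_gt0.
have : r < Num.min eps (t 0%N) by rewrite /r; lra.
rewrite lt_min => /andP[re rt].
apply: (@isolated_not_isometric R (X i) W r (fun x => in_space x)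
  (in_sequence X (Some 0%N))) => //.
- exact: (@decomposition_inj _ _ _ _ _ _ dec (Some i)).
- by move=> x /(isolated_decomposition dec re (i := Some i)).
- apply/(isolated_decomposition dec re (i := None)).
  by apply/isolated_sequence => //; exists 0%N.
Qed.

(* If [t k < t' k], then the k-th point of the sequence is isolated at scale
   [t k] in [W'] but not in [W], and all the other points that are isolated in
   [W] are isolated in [W']. *)
Lemma glued_space_isometric_le k : isometric W W' ->
  t k < eps -> t k < eps' -> t' k <= t k.
Proof.
move=> WW' ke ke'; rewrite leNgt; apply/negP => tt'; move: WW'.
apply: (@isolated_not_isometric R W W' (t k) (fun w => w)
  (in_sequence X (Some k))) => //.
- move=> w; have [[i|] [z <-]] := decomposition_cover dec w.
    move=> /(isolated_decomposition dec ke (i := Some i)) zk.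
    exact/(isolated_decomposition dec' ke' (i := Some i)).
  move=> /(isolated_decomposition dec ke (i := None)).
  move=> /(isolated_sequence _ (t_gt0 k))[l -> kl].
  apply/(isolated_decomposition dec' ke' (i := None)).
  apply/isolated_sequence => //; exists l => //; apply: lt_le_trans tt' _.
  apply: (sequence_le t'_gt0 t'_decr); rewrite leqNgt; apply/negP => /ltnW kl'.
  by have := sequence_le t_gt0 t_decr kl'; rewrite leNgt kl.
- apply/(isolated_decomposition dec' ke' (i := None)).
  by apply/isolated_sequence => //; exists k.
- move=> w wk wE; move: wk; rewrite wE.
  move=> /(isolated_decomposition dec ke (i := None)).
  by move=> /(isolated_sequence _ (t_gt0 k))[l [<-]]; rewrite ltxx.
Qed.

End glued_spaces_distinct.

(** * The embedding *)

(* The exponent leaves room for radii between [scale k] and [2 * scale k]. *)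
Fixpoint scale (R : realType) (k : nat) : R :=
  if k is k'.+1 then scale R k' / 2 ^+ k'.+2 else 1.

Lemma scale_gt0 (R : realType) k : 0 < scale R k.
Proof. by elim: k => //= k IH; rewrite divr_gt0// exprn_gt0. Qed.

Lemma scale_le1 (R : realType) k : scale R k <= 1.
Proof.
elim: k => //= k IH; rewrite ler_pdivrMr ?exprn_gt0// mul1r (le_trans IH)//.
by rewrite exprn_ege1// ler1n.
Qed.

Lemma injective_unbounded (f : nat -> nat) : injective f ->
  forall N, exists j, (N <= f j)%N.
Proof.
move=> finj N; apply: contrapT => n.
have fN j : (f j < N)%N by rewrite ltnNge; apply/negP => h; apply: n; exists j.
have : (size (map f (iota 0 N.+1)) <= size (iota 0 N))%N.
  apply: uniq_leq_size; first by rewrite map_inj_uniq// iota_uniq.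
  by move=> _ /mapP[j _ ->]; rewrite mem_iota fN.
by rewrite size_map !size_iota ltnn.
Qed.

(** Only radii of large index can be recovered from an isometry class, so the sequence has to come
    back near each point beyond every [N]. *)
Lemma recurrent_sequence (R : realType) (H : topologicalType)
    (dH : H -> H -> R) (h0 : H) :
  compact [set: H] ->
  (forall x (e : R), 0 < e -> nbhs x [set y | dH x y < e]) ->
  exists xs : nat -> H, forall h (e : R) N, 0 < e ->
    exists2 k, (N <= k)%N & dH (xs k) h < e.
Proof.
move=> cH dn.
have /choice[s sP] (m : nat) : exists s : seq H, forall y,
    exists2 x, x \in s & dH x y < m.+1%:R^-1.
  by apply: finite_net => //; rewrite invr_gt0.
(* The last component of the index only serves to repeat each point. *)
exists (fun k => if @pickle_inv (nat * nat * nat)%type k is Some q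
  then nth h0 (s q.1.1) q.1.2 else h0) => h e N e0.
pose m := Num.truncn e^-1.
have me : m.+1%:R^-1 < e.
  by rewrite invf_plt ?posrE// truncnS_gt.
have [x xs xh] := sP m h.
have [|j Nj] := @injective_unbounded (fun j => pickle (m, index x (s m), j)) _ N.
  by move=> j j' /(pcan_inj pickleK_inv)[].
exists (pickle (m, index x (s m), j)) => //.
by rewrite pickleK_inv /= nth_index// (lt_trans xh).
Qed.

Lemma ler_dist_bigmin (R : realDomainType) (I : finType) (P : pred I)
    (f g : I -> R) (m : R) : 0 <= m -> (forall i, `|f i - g i| <= m) ->
  `|\big[Num.min/1]_(i | P i) f i - \big[Num.min/1]_(i | P i) g i| <= m.
Proof.
move=> m0 fg; apply: (big_ind2 (fun x y => `|x - y| <= m)) => //.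
  by rewrite subrr normr0.
by move=> x x' y y'; exact: ler_dist_min.
Qed.

Section family.
Context {R : realType} (H : topologicalType) (dH : H -> H -> R).
Hypothesis mH : is_metric dH.
Hypothesis nH : forall x (A : set H),
  nbhs x A <-> exists2 e : R, 0 < e & [set y | dH x y < e] `<=` A.
Variables (n : nat) (v : idx n -> H) (X : idx n -> compactMetricType R).
Hypothesis v_inj : injective v.
Variable p : forall i, X i.
Variable L : R.
Hypothesis L1 : 1 <= L.
Variable xs : nat -> H.
Hypothesis xsP : forall h (e : R) N, 0 < e ->
  exists2 k, (N <= k)%N & dH (xs k) h < e.

(** The neutral value 1 caps the minimum and keeps it positive over an empty range, which
    [distance_to_others] has when there is a single [v i]. *)
Definition distance_to_all (h : H) : R := \big[Num.min/1]_(i : idx n) dH h (v i).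

Definition distance_to_others (h : H) (j : idx n) : R :=
  \big[Num.min/1]_(i | i != j) dH h (v i).

(** The height of the sequence vanishes at every [v i], that of [X j] at every [v i] but [v j],
    where the factor [L] has to lift it to the diameter of [X j]. With [1 <= L], no height is below
    the gap [distance_to_all]. *)
Definition cutoff (h : H) (i : option (idx n)) : R :=
  if i is Some j then L * distance_to_others h j else distance_to_all h.

Definition radii (h : H) (k : nat) : R :=
  scale R k * (1 + Num.min 1 (dH (xs k) h)).

Hypothesis LX : forall i (x y : X i), mdist x y <= cutoff (v i) (Some i).

Let dH_ge0 h h' : 0 <= dH h h'. Proof. by case: mH. Qed.
Let dHxx h : dH h h = 0. Proof. by case: mH => _ d _ _; apply/d. Qed.
Let dH_sym h h' : dH h h' = dH h' h. Proof. by case: mH. Qed.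
Let dH_triangle x y z : dH x z <= dH x y + dH y z. Proof. by case: mH. Qed.
Let dH_eq h h' : dH h h' = 0 -> h = h'. Proof. by case: mH => _ d _ _ /d. Qed.

Let L0 : 0 < L. Proof. exact: lt_le_trans L1. Qed.

Lemma distance_to_others_ge0 h j : 0 <= distance_to_others h j.
Proof.
apply: (big_ind (fun x => 0 <= x)) => // x y x0 y0.
by rewrite le_min x0.
Qed.

Lemma distance_to_all_ge0 h : 0 <= distance_to_all h.
Proof.
apply: (big_ind (fun x => 0 <= x)) => // x y x0 y0.
by rewrite le_min x0.
Qed.

Lemma distance_to_all_gt0 h : (forall i, v i <> h) -> 0 < distance_to_all h.
Proof.
move=> vh; apply: (big_ind (fun x => 0 < x)) => // [x y x0 y0|i _].
  by rewrite lt_min x0.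
by rewrite lt_neqAle dH_ge0 andbT eq_sym; apply/eqP => /dH_eq/esym; exact: vh.
Qed.

Lemma distance_to_all_le h i : distance_to_all h <= dH h (v i).
Proof. exact: bigmin_le_cond. Qed.

Lemma distance_to_others_le h i j : i != j -> distance_to_others h j <= dH h (v i).
Proof. by move=> ij; apply: bigmin_le_cond. Qed.

Lemma distance_to_all_others h j : distance_to_all h <= distance_to_others h j.
Proof.
apply: (big_ind (fun x => distance_to_all h <= x)).
- by rewrite /distance_to_all; exact: bigmin_le_id.
- by move=> x y hx hy; rewrite le_min hx.
- by move=> i _; exact: distance_to_all_le.
Qed.

Lemma cutoff_ge0 h i : 0 <= cutoff h i.
Proof.
case: i => [i|] /=; last exact: distance_to_all_ge0.
by rewrite mulr_ge0 ?distance_to_others_ge0// ltW.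
Qed.

Lemma distance_to_all_cutoff h i : distance_to_all h <= cutoff h i.
Proof.
case: i => [i|] //=; apply: le_trans (distance_to_all_others h i) _.
by rewrite ler_peMl// distance_to_others_ge0.
Qed.

Lemma radii_gt0 h k : 0 < radii h k.
Proof.
rewrite mulr_gt0 ?scale_gt0// ltr_pwDl// le_min dH_ge0 ler01//.
Qed.

Lemma radii_ge h k : scale R k <= radii h k.
Proof. by rewrite ler_peMr ?(ltW (scale_gt0 _ _))// lerDl le_min dH_ge0 ler01. Qed.

Lemma radii_le h k : radii h k <= scale R k * 2.
Proof.
by rewrite ler_pM2l ?scale_gt0// -[leRHS]/(1 + 1) lerD2l ge_min lexx.
Qed.

Lemma radii_decr h k : radii h k.+1 * 2 ^+ k.+1 <= radii h k.
Proof.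
apply: le_trans (radii_ge h k).
apply: le_trans (_ : scale R k.+1 * 2 * 2 ^+ k.+1 <= _).
  by rewrite ler_wpM2r ?radii_le ?exprn_ge0.
by rewrite -mulrA -exprS /= divfK// expf_neq0.
Qed.

Lemma radii_lipschitz h h' k : `|radii h k - radii h' k| <= dH h h'.
Proof.
rewrite -mulrBr normrM gtr0_norm ?scale_gt0//.
rewrite -[leRHS]mul1r ler_pM ?normr_ge0 ?(ltW (scale_gt0 _ _)) ?scale_le1//.
rewrite opprD addrACA subrr add0r minC [Num.min 1 (dH _ h')]minC.
apply: ler_dist_min; last by rewrite subrr normr0.
have := dH_triangle (xs k) h h'; have := dH_triangle (xs k) h' h.
by rewrite (dH_sym h' h) ler_norml => h1 h2; apply/andP; split; lra.
Qed.

Lemma dist_lipschitz h h' i : `|dH h (v i) - dH h' (v i)| <= dH h h'.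
Proof.
have := dH_triangle h h' (v i); have := dH_triangle h' h (v i).
by rewrite (dH_sym h' h) ler_norml => h1 h2; apply/andP; split; lra.
Qed.

Lemma distance_to_all_lipschitz h h' :
  `|distance_to_all h - distance_to_all h'| <= dH h h'.
Proof. by apply: ler_dist_bigmin => // i; exact: dist_lipschitz. Qed.

Lemma cutoff_lipschitz h h' i : `|cutoff h i - cutoff h' i| <= L * dH h h'.
Proof.
case: i => [i|] /=; last first.
  apply: le_trans (distance_to_all_lipschitz h h') _.
  by rewrite ler_peMl.
rewrite -mulrBr normrM gtr0_norm// ler_pM2l//.
by apply: ler_dist_bigmin => // j; exact: dist_lipschitz.
Qed.

Definition family_dist (h : H) :=
  @glued_dist R n X p (radii h) (cutoff h) (distance_to_all h).

Lemma family_dist_lipschitz h h' w w' :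
  `|family_dist h w w' - family_dist h' w w'| <= L * dH h h'.
Proof.
have dL : dH h h' <= L * dH h h' by rewrite ler_peMl.
apply: glued_dist_lipschitz => [k|i|].
- exact: le_trans (radii_lipschitz _ _ _) dL.
- exact: cutoff_lipschitz.
- exact: le_trans (distance_to_all_lipschitz _ _) dL.
Qed.

Definition family_glued (h : H) (vh : forall i, v i <> h) : compactMetricType R :=
  glued_space p (radii_gt0 h) (radii_decr h) (cutoff_ge0 h)
    (distance_to_all_gt0 vh) (distance_to_all_cutoff h).

(** The gap is positive only off the points [v i], whence the case distinction; at [v i] the value
    is [X i] itself. *)
Definition family (h : H) : compactMetricType R :=
  match pselect (exists i, v i = h) with
  | left ex => X (sval (cid ex))
  | right nex => family_glued (fun i vi => nex (ex_intro _ i vi))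
  end.

Lemma family_cases h :
  (exists2 i, v i = h & family h = X i) \/
  exists vh : forall i, v i <> h, family h = family_glued vh.
Proof.
rewrite /family; case: pselect => [ex|nex]; last by right; eexists.
by left; exists (sval (cid ex)) => //; exact: svalP (cid ex).
Qed.

Lemma family_v i : family (v i) = X i.
Proof.
have [[j /v_inj ji ->]|[vh _]] := family_cases (v i); first by rewrite ji.
by case: (vh i).
Qed.

(* At [h = v i] the family distance is only a pseudometric on the carrier, and
   [X i] is its metric quotient. *)
Lemma family_realizes h : exists C : family h -> @glued_carrier R n X -> Prop,
  [/\ forall x, exists w, C x w, forall w, exists x, C x w &
      forall x w x' w', C x w -> C x' w' ->
        mdist x x' = family_dist h w w'].
Proof.
have [[i <- ->]|[vh ->]] := family_cases h; last first.
  by exists (fun x w => x = w); split=> [x|w|x w x' w' <- <-//]; [exists x|exists w].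
have eps0 : distance_to_all (v i) = 0.
  apply/eqP; rewrite eq_le distance_to_all_ge0 andbT.
  by rewrite (le_trans (distance_to_all_le _ i))// dHxx.
have c0 j : j != Some i -> cutoff (v i) j = 0.
  case: j => [j|] ji //=; apply/eqP; rewrite mulf_eq0; apply/orP; right.
  rewrite eq_le distance_to_others_ge0 andbT.
  rewrite (le_trans (@distance_to_others_le _ i _ _)) ?dHxx//.
  by apply: contra_neq ji => ->.
have D0 w w' : family_dist (v i) w w' =
    glued_dist p (radii (v i)) (cutoff (v i)) 0 w w'.
  by rewrite /family_dist eps0.
have Dtri := @glued_dist_triangle R n X p (radii (v i)) (cutoff (v i)) 0
  (radii_gt0 (v i)) (cutoff_ge0 (v i)).
have Dsym := @glued_dist_sym R n X p (radii (v i)) (cutoff (v i)) 0.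
exists (fun x w => family_dist (v i) (in_space x) w = 0); split.
- move=> x; exists (in_space x).
  by rewrite D0 glued_dist_degenerate ?mdistxx//; exact: LX.
- move=> w; have [|x xw] := @glued_dist_collapse R n X p (radii (v i)) (cutoff (v i)) i
    (radii_gt0 (v i)) c0 _ w; first exact: LX.
  by exists x; rewrite D0.
- move=> x w x' w'; rewrite !D0 => xw x'w'.
  rewrite -(@glued_dist_degenerate R n X p (radii (v i)) (cutoff (v i)) i (@LX i)).
  have h1 := Dtri (in_space x) w (in_space x').
  have h2 := Dtri w w' (in_space x').
  have h3 := Dtri w (in_space x) w'.
  have h4 := Dtri (in_space x) (in_space x') w'.
  rewrite (Dsym w') x'w' in h2; rewrite (Dsym w (in_space x)) xw in h3.
  rewrite xw in h1; rewrite x'w' in h4.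
  by apply/eqP; rewrite eq_le; apply/andP; split; lra.
Qed.

(** Points realizing the same [w] of the carrier are related; this correspondence has distortion at
    most [L * dH h h']. *)
Lemma family_continuous h (e : R) : 0 < e ->
  nbhs h [set h' | (gh_dist (family h) (family h') < e%:E)%E].
Proof.
move=> e0; apply/nH; exists (e / L); first by rewrite divr_gt0.
move=> h' /= hh'.
have [C [C1 C2 dC]] := family_realizes h.
have [C' [C'1 C'2 dC']] := family_realizes h'.
apply: (@le_lt_trans _ _ (e / 2)%:E); last by rewrite lte_fin; lra.
apply: (@correspondence_gh_dist_le _ _ _
  (fun x y => exists2 w, C x w & C' y w)).
- by rewrite divr_gt0.
- split=> [x|y].
    by have [w xw] := C1 x; have [y yw] := C'2 w; exists y, w.
  by have [w yw] := C'1 y; have [x xw] := C2 w; exists x, w.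
- move=> x y x' y' [w xw yw] [w' x'w' y'w'].
  rewrite (dC _ _ _ _ xw x'w') (dC' _ _ _ _ yw y'w') -splitr.
  apply: le_trans (family_dist_lipschitz _ _ _ _) _.
  by rewrite mulrC -ler_pdivlMr// ltW.
Qed.

Lemma family_glued_inj h h' (vh : forall i, v i <> h) (vh' : forall i, v i <> h') :
  isometric (family_glued vh) (family_glued vh') -> h = h'.
Proof.
move=> hh'; apply: contrapT => nhh'.
pose m := Num.min (distance_to_all h) (distance_to_all h').
have m0 : 0 < m by rewrite lt_min !distance_to_all_gt0.
have hh's : isometric (family_glued vh') (family_glued vh).
  by apply/iso_class_eq/esym/iso_class_eq.
have [N NP] := sequence_small (radii_gt0 h) (radii_decr h) m0.
have [N' N'P] := sequence_small (radii_gt0 h') (radii_decr h') m0.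
have radii_eq k : (N <= k)%N -> (N' <= k)%N -> radii h k = radii h' k.
  move=> /NP + /N'P; rewrite !lt_min => /andP[k1 k2] /andP[k3 k4].
  by apply/eqP; rewrite eq_le (glued_space_isometric_le hh's)//
    (glued_space_isometric_le hh').
(* If [xs k] is within [e] of [h], equal radii put it within [e] of [h'] as well, since [e < 1]
   makes the cap ineffective; then [dH h h' < 2 * e], a contradiction. *)
pose e := Num.min 1 (dH h h') / 2.
have d0 : 0 < dH h h'.
  by rewrite lt_neqAle dH_ge0 andbT eq_sym; apply/eqP => /dH_eq.
have e20 : 0 < Num.min 1 (dH h h') by rewrite lt_min ltr01.
have e0 : 0 < e by rewrite divr_gt0.
have [k] := xsP h (maxn N N') e0; rewrite geq_max => /andP[Nk N'k] xk.
have := radii_eq k Nk N'k => /(mulfI (lt0r_neq0 (scale_gt0 R k)))/addrI => uu.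
have : Num.min 1 (dH (xs k) h') < e by rewrite -uu gt_min xk orbT.
have e1 : Num.min 1 (dH h h') <= 1 by rewrite ge_min lexx.
have e2 : Num.min 1 (dH h h') <= dH h h' by rewrite ge_min lexx orbT.
rewrite ltNge => /negP; apply; rewrite le_min; apply/andP; split.
  by rewrite /e; lra.
have := dH_triangle h (xs k) h'; rewrite (dH_sym h (xs k)).
by move: xk; rewrite /e; lra.
Qed.

Lemma family_inj : (forall i j, isometric (X i) (X j) -> i = j) ->
  injective (fun h => iso_class (family h)).
Proof.
move=> Xinj h h' /iso_class_eq.
have [[i <- ->]|[vh ->]] := family_cases h;
  have [[j <- ->]|[vh' ->]] := family_cases h'.
- by move=> /Xinj ->.
- by move=> /glued_space_not_piece.
- by move=> /iso_class_eq/esym/iso_class_eq/glued_space_not_piece.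
- exact: family_glued_inj.
Qed.

End family.

Lemma assouad_dim_ge0 (R : realType) (X : compactMetricType R) :
  (0 <= assouad_dim X)%E.
Proof.
by apply: le_ereal_inf_tmp => _ [s [/ltW s0 _] <-]; rewrite lee_fin.
Qed.

Section classes.
Context {R : realType}.

(** All that the construction asks of a class. The index [i0] ensures that there is a piece in the
    class, from which lower bounds on dimensions are taken. *)
Definition gluing_closed (P : compactMetricType R -> Prop) :=
  forall n (i0 : idx n) (X : idx n -> compactMetricType R) (p : forall i, X i) t c eps
    (t_gt0 : forall k : nat, 0 < t k)
    (t_decr : forall k, t k.+1 * 2 ^+ k.+1 <= t k)
    (c_ge0 : forall i, 0 <= c i) (eps_gt0 : 0 < eps) (eps_c : forall i, eps <= c i),
  (forall i, P (X i)) -> P (glued_space p t_gt0 t_decr c_ge0 eps_gt0 eps_c).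

Lemma ultrametric_gluing_closed : gluing_closed (fun X => is_ultrametric X).
Proof.
move=> n i0 X p t c eps t_gt0 t_decr c_ge0 eps_gt0 eps_c Xu x y z.
exact: glued_dist_ultra.
Qed.

(** Upper bounds hold because each [X i] has these dimensions and the sequence has dimensions at
    most 0; lower bounds come from the piece [i0]. *)
Lemma dimensions_gluing_closed (l a1 a2 a3 a4 : \bar R) :
  [/\ 0 <= l, 0 <= a1, 0 <= a2, 0 <= a3 & 0 <= a4]%E ->
  gluing_closed (fun X => [/\ topological_dim R X = l, hausdorff_dim X = a1,
    packing_dim X = a2, upper_box_dim X = a3 & assouad_dim X = a4]).
Proof.
move=> [l0 a10 a20 a30 a40] n i0 X p t c eps t_gt0 t_decr c_ge0 eps_gt0 eps_c XP.
have dec := glued_decomposition p t_gt0 t_decr c_ge0 eps_gt0 eps_c.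
have [X0 X1 X2 X3 X4] := XP i0.
split; apply/eqP; rewrite eq_le; apply/andP; split.
- apply: (decomposition_topological_dim_le dec l0) => -[i|] /=.
    by have [-> _ _ _ _] := XP i.
  exact: le_trans (sequence_topological_dim _ _) l0.
- by rewrite -[leLHS]X0 (topological_dim_le_decomposition dec (Some i0)).
- apply: (decomposition_hausdorff_dim_le dec a10) => -[i|] /=.
    by have [_ -> _ _ _] := XP i.
  exact: le_trans (sequence_hausdorff_dim _ _) a10.
- by rewrite -[leLHS]X1 (hausdorff_dim_le_decomposition dec (Some i0)).
- apply: (decomposition_packing_dim_le dec a20) => -[i|] /=.
    by have [_ _ -> _ _] := XP i.
  exact: le_trans (sequence_packing_dim _ _) a20.
- by rewrite -[leLHS]X2 (packing_dim_le_decomposition dec (Some i0)).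
- apply: (decomposition_upper_box_dim_le dec a30) => -[i|] /=.
    by have [_ _ _ -> _] := XP i.
  exact: le_trans (sequence_upper_box_dim _ _) a30.
- by rewrite -[leLHS]X3 (upper_box_dim_le_decomposition dec (Some i0)).
- apply: (decomposition_assouad_dim_le dec a40) => -[i|] /=.
    by have [_ _ _ _ ->] := XP i.
  exact: le_trans (sequence_assouad_dim _ _) a40.
- rewrite -[leLHS]X4 (assouad_dim_le_decomposition dec (Some i0))//.
  exact: assouad_dim_ge0.
Qed.

Lemma exists_embedding (P : compactMetricType R -> Prop) (H : topologicalType)
    (n : nat) (v : idx n -> H) (X : idx n -> compactMetricType R) :
  gluing_closed P -> compact [set: H] -> metrizable R H -> injective v ->
  forall i0 : idx n,
  (forall i, P (X i)) -> (forall i j, isometric (X i) (X j) -> i = j) ->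
  exists F : H -> compactMetricType R,
    [/\ forall h, P (F h), forall i, F (v i) = X i,
        injective (fun h => iso_class (F h)) & continuous (fun h => iso_class (F h))].
Proof.
move=> Pglue cH [dH mH nH] v_inj i0 PX Xinj.
have dHn x (e : R) : 0 < e -> nbhs x [set y | dH x y < e].
  by move=> e0; apply/nH; exists e.
have [xs xsP] := recurrent_sequence (v i0) cH dHn.
have /dependent_functional_choice[p _] i : exists x : X i, True.
  by have [x] := @compact_metric_nonempty _ (X i); exists x.
have /choice[M MP] i : exists M : R, 0 < M /\ forall x y : X i, mdist x y <= M.
  by have [M] := @metric_bounded R (X i); exists M.
pose m i := distance_to_others dH v (v i) i.
have m0 i : 0 < m i.
  apply: (big_ind (fun x => 0 < x)) => // [x y x0 y0|j ji].
    by rewrite lt_min x0.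
  have [d0 dE _ _] := mH; rewrite lt_neqAle d0 andbT eq_sym.
  by apply: contra_neq ji => /dE/v_inj.
have Mm0 i : 0 <= M i / m i by rewrite divr_ge0 ?(ltW (m0 _))// ltW// (MP i).1.
(* One factor for all pieces: [M i <= L * m i] for each [i], and the term 1 gives [1 <= L]. *)
pose L := 1 + \sum_i M i / m i.
have L1 : 1 <= L by rewrite lerDl sumr_ge0.
have LX i (x y : X i) : mdist x y <= cutoff dH v L (v i) (Some i).
  rewrite /cutoff (le_trans ((MP i).2 x y))// -ler_pdivrMr ?m0// /L.
  by rewrite (bigD1 i)//= addrCA lerDl addr_ge0// sumr_ge0.
exists (family mH v p L1 xs); split.
- move=> h; have [[i _ ->]|[vh ->]] := family_cases mH v p L1 xs h; first exact: PX.
  exact: Pglue.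
- by move=> i; exact: family_v.
- exact: family_inj.
- by apply: iso_class_continuous => h e e0; exact: family_continuous.
Qed.

End classes.

Theorem theorem1p3 (R : realType) (S : set (gh_space R))
  (hS : (exists l a1 a2 a3 a4 : \bar R,
           [/\ l = +oo%E \/ (exists k : nat, l = k%:R%:E),
               [/\ 0 <= a1, 0 <= a2, 0 <= a3 & 0 <= a4]%E,
               [/\ l <= a1, a1 <= a2, a2 <= a3 & a3 <= a4]%E &
               S = dim_class l a1 a2 a3 a4])
        \/ S = ultrametric_class R)
  (n : nat) (hn : (1 <= n)%N)
  (H : topologicalType) (Hcompact : compact [set: H])
  (Hmetrizable : metrizable R H)
  (v : 'I_n.+1 -> H) (v_inj : injective v)
  (X : 'I_n.+1 -> compactMetricType R)
  (XS : forall i, S (iso_class (X i)))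
  (X_gh : forall i j, i != j -> (0 < gh_dist (X i) (X j))%E) :
  exists Phi : H -> S,
    topological_embedding Phi /\
    forall i, val (Phi (v i)) = iso_class (X i).
Proof.
have [P PS Pglue] : exists2 P : compactMetricType R -> Prop,
    S = [set iso_class Y | Y in P] & gluing_closed P.
  case: hS => [[l [a1 [a2 [a3 [a4 [hl ha _ ->]]]]]]|->]; last first.
    by exists (fun Y => is_ultrametric Y); [|exact: ultrametric_gluing_closed].
  exists (fun Y : compactMetricType R => [/\ topological_dim R Y = l, hausdorff_dim Y = a1,
    packing_dim Y = a2, upper_box_dim Y = a3 & assouad_dim Y = a4]) => //.
  apply: dimensions_gluing_closed.
  case: ha => ? ? ? ?; split=> //.
  by case: hl => [->|[k ->]]; rewrite ?leey ?lee_fin.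
(* Membership of the class of [X i] in [S] yields a space satisfying [P] that is isometric to [X i];
   the family is built from these spaces. *)
have /choice[Y YP] i : exists Y, P Y /\ iso_class Y = iso_class (X i).
  by have := XS i; rewrite PS => -[Y]; exists Y.
have [|||F [PF FY Finj Fcont]] := @exists_embedding R P H n.+1
  (v \o @ord_of_idx n.+1) (Y \o @ord_of_idx n.+1) Pglue Hcompact Hmetrizable _
  (idx_of_ord ord0).
- by apply: inj_comp => //; exact: can_inj (@ord_of_idxK n.+1).
- by move=> i; exact: (YP _).1.
- move=> i j /iso_class_eq /=; rewrite (YP _).2 (YP _).2 => /iso_class_eq ij.
  apply: (can_inj (@ord_of_idxK n.+1)); apply: contrapT => /eqP /X_gh gh0.
  have := gh0; rewrite ltNge => /negP; apply.
  apply/lee_addgt0Pr => e e0; rewrite add0e ltW//.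
  exact: isometric_gh_dist.
have SF h : S (iso_class (F h)) by rewrite PS; exists (F h).
pose Phi (h : H) : S := exist _ (iso_class (F h)) (mem_set (SF h)).
exists Phi; split.
  apply: topological_embedding_compact => //.
  by move=> h h' /(congr1 val)/Finj.
move=> i; rewrite /= -(YP i).2.
by have := FY (idx_of_ord i); rewrite /= idx_of_ordK => ->.
Qed.
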